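(* Let $T$ be a densely defined, closed operator on $\mathcal{H}$ which satisfies (a) $D(|T|^{1/2})=D(|T^*|^{1/2})$; (b) there exists $B\in\mathcal{B}(\mathcal{H})$ such that $0\in\rho(T+B)$. Then there exists a unique hyper-solvable sesquilinear form $\Omega$ with associated operator $T$.
   Context: $\mathcal{H}$ is a complex Hilbert space with inner product $\langle\cdot,\cdot\rangle$ (linear in the first variable) and norm $\|\cdot\|$; sesquilinear forms are linear in the first and conjugate-linear in the second variable. $\mathcal{B}(\mathcal{H})$ is the set of bounded everywhere defined operators on $\mathcal{H}$ and $\rho(A)$ denotes the resolvent set of $A$. Let $\mathcal{D}$ be a dense subspace of $\mathcal{H}$. A sesquilinear form $\Omega$ on $\mathcal{D}$ is q-closed with respect to a norm $\|\cdot\|_\Omega$ on $\mathcal{D}$ if: (i) there is $\alpha>0$ with $\|\xi\|\le\alpha\|\xi\|_\Omega$ for all $\xi\in\mathcal{D}$; (ii) $\mathcal{E}_\Omega:=(\mathcal{D},\|\cdot\|_\Omega)$ is a reflexive Banach space; (iii) there is $\beta>0$ with $|\Omega(\xi,\eta)|\le\beta\|\xi\|_\Omega\|\eta\|_\Omega$ for all $\xi,\eta\in\mathcal{D}$. Let $\mathcal{E}_\Omega^\times$ be the space of bounded conjugate linear functionals on $\mathcal{E}_\Omega$. $\mathfrak{P}(\Omega)$ is the set of bounded sesquilinear forms $\Upsilon$ on $\mathcal{H}$ such that: (1) if $\xi\in\mathcal{D}$ and $(\Omega+\Upsilon)(\xi,\eta)=0$ for all $\eta\in\mathcal{D}$ then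 $\xi=0$; (2) for every $\Lambda\in\mathcal{E}_\Omega^\times$ there is $\xi\in\mathcal{D}$ with $\Lambda(\eta)=(\Omega+\Upsilon)(\xi,\eta)$ for all $\eta\in\mathcal{D}$. $\Omega$ is solvable if it is q-closed with respect to some norm $\|\cdot\|_\Omega$ and $\mathfrak{P}(\Omega)\neq\emptyset$ (all such norms are known to be equivalent). The operator $T$ associated to a solvable form $\Omega$ on $\mathcal{D}$ is given by: $\xi\in D(T)$ and $T\xi=\chi$ if and only if $\xi\in\mathcal{D}$, $\chi\in\mathcal{H}$ and $\Omega(\xi,\eta)=\langle\chi,\eta\rangle$ for all $\eta\in\mathcal{D}$. It is known that the associated operator is closed and densely defined. A solvable form $\Omega$ on a dense subspace $\mathcal{D}$ with associated operator $T$ is hyper-solvable if $\mathcal{D}=D(|T|^{1/2})$, where $|T|=(T^*T)^{1/2}$. *)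

(* Defs.v *)
From HB Require Import structures.
From mathcomp Require Import all_boot all_order all_algebra.
From mathcomp Require Import complex.
From mathcomp Require Import all_classical all_reals all_analysis.

Set Implicit Arguments.
Unset Strict Implicit.
Unset Printing Implicit Defensive.

Import Order.TTheory GRing.Theory Num.Theory numFieldNormedType.Exports.

Local Open Scope classical_set_scope.
Local Open Scope complex_scope.
Local Open Scope ring_scope.

(* [{dot _ for Num.conj}] is linear in the first variable and conjugate-linear
   in the second one. *)
Record hilbert (R : realType) := Hilbert {
  hcarrier :> completeNormedModType R[i];
  inner : {dot hcarrier for (@Num.conj R[i])};
  inner_norm : forall x : hcarrier, `|x| ^+ 2 = inner x x
}.

Notation "'<|' x , y '|>'" := (inner _ x y)
  (at level 0, x at level 99, y at level 99,
   format "'<|' x ,  y '|>'") : ring_scope.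

Definition lin_subspace (R : realType) (V : lmodType R[i]) (D : set V) :
    Prop :=
  GRing.submod_closed (mem D).

(* An operator in H is represented by its graph; [is_operator] says that a
   relation is the graph of a linear map defined on a subspace. *)
Definition graph (R : realType) (H : hilbert R) : Type := set (H * H).

Definition is_operator (R : realType) (H : hilbert R) (T : graph H) : Prop :=
  lin_subspace T /\ forall x y z : H, T (x, y) -> T (x, z) -> y = z.

Definition dom (R : realType) (H : hilbert R) (T : graph H) : set H :=
  [set x | exists y, T (x, y)].

Definition closed_op (R : realType) (H : hilbert R) (T : graph H) : Prop :=
  closed (T : set (H * H)%type).

Definition graph_of (R : realType) (H : hilbert R) (f : H -> H) : graph H :=
  [set p | p.2 = f p.1].

Definition op_add (R : realType) (H : hilbert R) (S T : graph H) : graph H :=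
  [set p | exists y z, [/\ S (p.1, y), T (p.1, z) & p.2 = y + z]].

Definition op_comp (R : realType) (H : hilbert R) (S T : graph H) : graph H :=
  [set p | exists y, T (p.1, y) /\ S (y, p.2)].

Definition op_inv (R : realType) (H : hilbert R) (T : graph H) : graph H :=
  [set p | T (p.2, p.1)].

(* This is the graph of an operator exactly when [dom T] is dense. *)
Definition adjoint (R : realType) (H : hilbert R) (T : graph H) : graph H :=
  [set p | forall x y : H, T (x, y) -> <|y, p.1|> = <|x, p.2|>].

Definition selfadjoint (R : realType) (H : hilbert R) (T : graph H) : Prop :=
  [/\ is_operator T, dense (dom T) & adjoint T = T].

Definition positive_op (R : realType) (H : hilbert R) (T : graph H) : Prop :=
  forall x y : H, T (x, y) -> 0 <= <|y, x|>.

(* The positive self-adjoint square root of A; it exists and is unique when A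
   is positive and self-adjoint, and set0 is a dummy value otherwise. *)
Definition op_sqrt (R : realType) (H : hilbert R) (A : graph H) : graph H :=
  xget (set0 : set (H * H)%type)
    [set S | [/\ selfadjoint S, positive_op S & op_comp S S = A]].

Definition op_abs (R : realType) (H : hilbert R) (T : graph H) : graph H :=
  op_sqrt (op_comp (adjoint T) T).

Definition bounded_op (R : realType) (H : hilbert R) (B : {linear H -> H}) :
    Prop :=
  exists c : R[i], forall x : H, `|B x| <= c * `|x|.

Definition resolvent_set (R : realType) (H : hilbert R) (T : graph H) :
    set R[i] :=
  [set l | exists2 S : {linear H -> H}, bounded_op S &
     op_inv (op_add T (graph_of (fun x => - (l *: x)))) = graph_of S].

(* The functions N, L and Lambda below are defined on all of H, but only their
   values on D are meaningful. *)
Definition is_norm_on (R : realType) (H : hilbert R) (D : set H)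
    (N : H -> R[i]) : Prop :=
  [/\ forall x, D x -> 0 <= N x,
      forall x, D x -> N x = 0 -> x = 0,
      forall a x, D x -> N (a *: x) = `|a| * N x &
      forall x y, D x -> D y -> N (x + y) <= N x + N y].

Definition complete_on (R : realType) (H : hilbert R) (D : set H)
    (N : H -> R[i]) : Prop :=
  forall u : nat -> H, (forall n, D (u n)) ->
    (forall e : R[i], 0 < e ->
       exists n0, forall m n, (n0 <= m)%N -> (n0 <= n)%N ->
         N (u m - u n) < e) ->
    exists2 x, D x &
      forall e : R[i], 0 < e ->
        exists n0, forall n, (n0 <= n)%N -> N (u n - x) < e.

Definition functional_bound (R : realType) (H : hilbert R) (D : set H)
    (N : H -> R[i]) (L : H -> R[i]) (c : R[i]) : Prop :=
  0 <= c /\ forall x, D x -> `|L x| <= c * N x.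

Definition dual_on (R : realType) (H : hilbert R) (D : set H) (N : H -> R[i]) :
    set (H -> R[i]) :=
  [set L | (forall a x y, D x -> D y -> L (a *: x + y) = a * L x + L y) /\
           exists c, functional_bound D N L c].

Definition antidual_on (R : realType) (H : hilbert R) (D : set H)
    (N : H -> R[i]) : set (H -> R[i]) :=
  [set L | (forall a x y, D x -> D y ->
              L (a *: x + y) = Num.conj a * L x + L y) /\
           exists c, functional_bound D N L c].

(* Elements of the bidual.  The norm of L is the least c such that
   [functional_bound D N L c], so the second clause says |F L| <= M |L|; it
   also forces F L to depend only on the restriction of L to D. *)
Definition bidual_on (R : realType) (H : hilbert R) (D : set H) (N : H -> R[i]) :
    set ((H -> R[i]) -> R[i]) :=
  [set F | (forall a L1 L2, dual_on D N L1 -> dual_on D N L2 ->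
              F (fun x => a * L1 x + L2 x) = a * F L1 + F L2) /\
           exists M : R[i], forall L c, dual_on D N L ->
             functional_bound D N L c -> `|F L| <= M * c].

Definition reflexive_on (R : realType) (H : hilbert R) (D : set H)
    (N : H -> R[i]) : Prop :=
  forall F, bidual_on D N F ->
    exists2 x, D x & forall L, dual_on D N L -> F L = L x.

(* Only the values of [fval] on [fdom] are meaningful. *)
Record sform (R : realType) (H : hilbert R) := SForm {
  fdom : set H;
  fval :> H -> H -> R[i]
}.

Definition form_eq (R : realType) (H : hilbert R) (O1 O2 : sform H) : Prop :=
  fdom O1 = fdom O2 /\
  forall x y, fdom O1 x -> fdom O1 y -> O1 x y = O2 x y.

Definition sesquilinear_on (R : realType) (H : hilbert R) (D : set H)
    (f : H -> H -> R[i]) : Prop :=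
  (forall a x y z, D x -> D y -> D z ->
     f (a *: x + y) z = a * f x z + f y z) /\
  (forall a x y z, D x -> D y -> D z ->
     f x (a *: y + z) = Num.conj a * f x y + f x z).

Definition q_closed (R : realType) (H : hilbert R) (O : sform H)
    (N : H -> R[i]) : Prop :=
  [/\ is_norm_on (fdom O) N,
      exists2 alpha : R[i], 0 < alpha &
        forall x, fdom O x -> `|x| <= alpha * N x,
      complete_on (fdom O) N /\ reflexive_on (fdom O) N &
      exists2 beta : R[i], 0 < beta &
        forall x y, fdom O x -> fdom O y -> `|O x y| <= beta * N x * N y].

Definition bounded_form (R : realType) (H : hilbert R) (U : H -> H -> R[i]) :
    Prop :=
  sesquilinear_on setT U /\
  exists c : R[i], forall x y : H, `|U x y| <= c * `|x| * `|y|.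

Definition perturbations (R : realType) (H : hilbert R) (O : sform H)
    (N : H -> R[i]) : set (H -> H -> R[i]) :=
  [set U | [/\ bounded_form U,
     forall x, fdom O x ->
       (forall y, fdom O y -> O x y + U x y = 0) -> x = 0 &
     forall Lambda, antidual_on (fdom O) N Lambda ->
       exists2 x, fdom O x &
         forall y, fdom O y -> Lambda y = O x y + U x y]].

Definition solvable (R : realType) (H : hilbert R) (O : sform H) : Prop :=
  [/\ lin_subspace (fdom O), dense (fdom O), sesquilinear_on (fdom O) O &
      exists2 N, q_closed O N & perturbations O N !=set0].

Definition associated_op (R : realType) (H : hilbert R) (O : sform H) :
    graph H :=
  [set p | fdom O p.1 /\ forall y, fdom O y -> O p.1 y = <|p.2, y|>].

Definition hyper_solvable (R : realType) (H : hilbert R) (O : sform H) : Prop :=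
  solvable O /\ fdom O = dom (op_sqrt (op_abs (associated_op O))).

(* Main.v *)
Require Import Defs.
From HB Require Import structures.
From mathcomp Require Import all_boot all_order all_algebra.
From mathcomp Require Import complex.
From mathcomp Require Import all_classical all_reals all_analysis.
From mathcomp Require Import ring lra.
Set Implicit Arguments.
Unset Strict Implicit.
Unset Printing Implicit Defensive.
Import Order.TTheory GRing.Theory Num.Theory numFieldNormedType.Exports.
Local Open Scope classical_set_scope.
Local Open Scope complex_scope.
Local Open Scope ring_scope.

(* With the polar decomposition T = U |T| one has |T*|^(1/2) = U |T|^(1/2) U*,
   and the form is O(x, y) = <U |T|^(1/2) x, |T*|^(1/2) y> on the common domain
   D of the two square roots.  By the closed graph theorem their graph norms on
   D are equivalent, so O is bounded.  A bounded antilinear functional on D is,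
   by Riesz, y |-> <w, y> + <|T*|^(1/2) w, |T*|^(1/2) y>, and its second term is
   O(U* w, y); what remains is a functional given by a vector of H, which
   T + B, being onto, represents as well.  Uniqueness: any other such form has
   a complete norm on D, again equivalent to the graph norm, and it agrees with
   O on D(T), which is dense in D for that norm.

   Positive self-adjoint operators are written S = {(c x, s x)} with
   c = (1 + S^2)^(-1/2) and s = S c bounded, and the square roots come from
   von Neumann's resolvent (1 + T* T)^(-1). *)

(** [op_sqrt] picks an arbitrary positive self-adjoint root, so its value is known only once a root
    is exhibited and proved unique. No spectral calculus is used for this: an unbounded positive
    operator is always handled through bounded symmetric ones. The pair (c, s) also makes x |-> (c
    x, s x) an isometry of H onto the graph, so the form domain [range c] with its graph norm is a
    copy of H, and completeness, reflexivity and Riesz representation are carried over from H. Two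
    roots are taken in succession, of T* T and then of |T|. Von Neumann's argument gives (1 + T*
    T)^(-1), but the second root needs (1 + |T|)^(-1), which is obtained from (c, s). On the side of
    T*, conjugation by U turns |T| into a positive root of T T* and |T|^(1/2) into a root of that
    root; uniqueness identifies both. Condition (a) lets both arguments of the form run through one
    space, and condition (b) supplies the perturbation (x, y) |-> <B x, y>. *)

Section RealNorm.
Variables (R : realType) (V : normedModType R[i]).
Implicit Types (x y : V) (a : R[i]).

(** Norms take values in R[i], which is only partially ordered; real-valued copies make suprema,
    infima, [lra] and [nra] available. *)
Definition nm x : R := complex.Re `|x|.
Definition cn a : R := complex.Re `|a|.

Lemma cnE a : `|a| = (cn a)%:C.
Proof. by rewrite /cn RRe_real// normr_real. Qed.

Lemma nmE x : `|x| = (nm x)%:C.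
Proof. by rewrite /nm RRe_real// ger0_real. Qed.

Lemma nm_ge0 x : 0 <= nm x.
Proof. by have := normr_ge0 x; rewrite nmE lecR. Qed.

Lemma cn_ge0 a : 0 <= cn a.
Proof. by have := normr_ge0 a; rewrite cnE lecR. Qed.

Lemma nm_le0 x : nm x <= 0 -> x = 0.
Proof.
move=> h; apply/eqP; rewrite -normr_eq0 nmE.
by have -> : nm x = 0 by apply/le_anti; rewrite h nm_ge0.
Qed.

Lemma nm0 : nm 0 = 0.
Proof. by rewrite /nm normr0. Qed.

Lemma nmD x y : nm (x + y) <= nm x + nm y.
Proof. by have := ler_normD x y; rewrite !nmE -rmorphD lecR. Qed.

Lemma nmN x : nm (- x) = nm x.
Proof. by rewrite /nm normrN. Qed.

Lemma nmC x y : nm (x - y) = nm (y - x).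
Proof. by rewrite -nmN opprB. Qed.

Lemma nmB x y : nm (x - y) <= nm x + nm y.
Proof. by rewrite -[nm y]nmN nmD. Qed.

Lemma nm_tri x y z : nm (x - z) <= nm (x - y) + nm (y - z).
Proof. by rewrite -[x - z](subrKA y) nmD. Qed.

Lemma nmZ a x : nm (a *: x) = cn a * nm x.
Proof. by rewrite /nm normrZ cnE nmE -rmorphM. Qed.

Lemma cn_real (t : R) : cn (t%:C) = `|t|.
Proof.
by rewrite /cn normc_def /= expr0n/= addr0 sqrtr_sqr.
Qed.

Lemma nmZr (t : R) x : nm (t%:C *: x) = `|t| * nm x.
Proof. by rewrite nmZ cn_real. Qed.

Lemma cnM a b : cn (a * b) = cn a * cn b.
Proof. by rewrite /cn normrM !cnE -rmorphM. Qed.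

Lemma cnD a b : cn (a + b) <= cn a + cn b.
Proof. by have := ler_normD a b; rewrite !cnE -rmorphD lecR. Qed.

Lemma cnN a : cn (- a) = cn a.
Proof. by rewrite /cn normrN. Qed.

Lemma cn_le0 a : cn a <= 0 -> a = 0.
Proof.
move=> h; apply/eqP; rewrite -normr_eq0 cnE.
by have -> : cn a = 0 by apply/le_anti; rewrite h cn_ge0.
Qed.

Lemma cn_conj a : cn (Num.conj a) = cn a.
Proof. by rewrite /cn norm_conjC. Qed.

Lemma Re_le_cn a : complex.Re a <= cn a.
Proof.
have := normc_ge_Re a; rewrite cnE lecR; apply: le_trans; exact: ler_norm.
Qed.

End RealNorm.

(** * Limits and neighbourhoods through the real-valued norm *)

Definition lim_seq (R : realType) (V : normedModType R[i]) (u : nat -> V)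
    (x : V) : Prop :=
  forall e : R, 0 < e -> exists n0, forall n, (n0 <= n)%N -> nm (u n - x) < e.

Definition cauchy_nm (R : realType) (V : normedModType R[i]) (u : nat -> V) :
    Prop :=
  forall e : R, 0 < e -> exists n0, forall m n, (n0 <= m)%N -> (n0 <= n)%N ->
    nm (u m - u n) < e.

Section Topology.
Variable R : realType.

Lemma pos_Re (e : R[i]) : 0 < e -> 0 < complex.Re e /\ e = (complex.Re e)%:C.
Proof.
by case: e => a b; rewrite ltcE/= => /andP[/eqP-> ?].
Qed.

Lemma nbhs_nm (V : normedModType R[i]) (x : V) (A : set V) :
  nbhs x A <-> exists2 e : R, 0 < e & forall y, nm (y - x) < e -> A y.
Proof.
split.
  move=> /nbhs_ballP[e /= /pos_Re[e0 eE] h]; exists (complex.Re e) => // y yx.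
  by apply: h; rewrite -ball_normE /= nmE eE ltcR nmC.
move=> [e e0 h]; apply/nbhs_ballP; exists e%:C; first by rewrite /= ltcR.
by move=> y; rewrite -ball_normE /= nmE ltcR nmC; apply: h.
Qed.

Lemma cauchy_nm_lim (V : completeNormedModType R[i]) (u : nat -> V) :
  cauchy_nm u -> exists x, lim_seq u x.
Proof.
move=> cu.
have /cauchy_cvg : cauchy (u @ \oo).
  apply/cauchy_ballP => _/posnumP[e].
  have [e0 eE] := pos_Re (gt0 e).
  have [n0 h] := cu _ e0.
  exists (u @` [set n | (n0 <= n)%N], u @` [set n | (n0 <= n)%N]) => /=.
    by split; exists n0 => // n n0n /=; exists n.
  move=> [_ _] /= [[m n0m <-] [n n0n <-]].
  by rewrite -ball_normE /= nmE eE ltcR; apply: h.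
move=> /cvg_ex[x /cvgrPdistC_lt ux]; exists x => e e0.
have e0' : 0 < e%:C :> R[i] by rewrite ltcR.
have [n0 _ h] := ux _ e0'; exists n0 => n n0n.
by have := h n n0n; rewrite /= nmE ltcR.
Qed.

End Topology.

(** * Inner product, Cauchy-Schwarz inequality and formal adjoints *)

Section InnerProduct.
Variables (R : realType) (H : hilbert R).
Implicit Types (x y z : H) (a : R[i]).

Lemma ipDl x y z : <|x + y, z|> = <|x, z|> + <|y, z|>.
Proof. exact: linearDl. Qed.

Lemma ipDr x y z : <|z, x + y|> = <|z, x|> + <|z, y|>.
Proof. exact: linearDr. Qed.

Lemma ipNl x z : <|- x, z|> = - <|x, z|>.
Proof. exact: linearNl. Qed.

Lemma ipNr x z : <|z, - x|> = - <|z, x|>.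
Proof. exact: linearNr. Qed.

Lemma ipBl x y z : <|x - y, z|> = <|x, z|> - <|y, z|>.
Proof. by rewrite ipDl ipNl. Qed.

Lemma ipBr x y z : <|z, x - y|> = <|z, x|> - <|z, y|>.
Proof. by rewrite ipDr ipNr. Qed.

Lemma ipZl a x z : <|a *: x, z|> = a * <|x, z|>.
Proof. exact: linearZl_LR. Qed.

Lemma ipZr a x z : <|z, a *: x|> = Num.conj a * <|z, x|>.
Proof. exact: linearZr_LR. Qed.

Lemma ip0l z : <|0, z|> = 0.
Proof. exact: linear0l. Qed.

Lemma ip0r z : <|z, 0|> = 0.
Proof. exact: linear0r. Qed.

Lemma ipC x y : <|x, y|> = Num.conj <|y, x|>.
Proof. by rewrite hermC expr0 mul1r. Qed.

Definition rip x y : R := complex.Re <|x, y|>.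

Lemma conjE a : Num.conj a = (complex.Re a -i* complex.Im a)%C.
Proof. by case: a. Qed.

Lemma ripC x y : rip x y = rip y x.
Proof. by rewrite /rip ipC conjE. Qed.

Lemma ReD a b : complex.Re (a + b) = complex.Re a + complex.Re b.
Proof. by case: a; case: b. Qed.

Lemma ReN a : complex.Re (- a) = - complex.Re a.
Proof. by case: a. Qed.

Lemma ripDl x y z : rip (x + y) z = rip x z + rip y z.
Proof. by rewrite /rip ipDl ReD. Qed.

Lemma ripDr x y z : rip z (x + y) = rip z x + rip z y.
Proof. by rewrite /rip ipDr ReD. Qed.

Lemma ripNl x z : rip (- x) z = - rip x z.
Proof. by rewrite /rip ipNl ReN. Qed.

Lemma ripNr x z : rip z (- x) = - rip z x.
Proof. by rewrite /rip ipNr ReN. Qed.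

Lemma ripBl x y z : rip (x - y) z = rip x z - rip y z.
Proof. by rewrite ripDl ripNl. Qed.

Lemma ripZl (t : R) x z : rip (t%:C *: x) z = t * rip x z.
Proof. by rewrite /rip ipZl; case: <|x, z|> => u v /=; rewrite mul0r subr0. Qed.

Lemma ripZr (t : R) x z : rip z (t%:C *: x) = t * rip z x.
Proof. by rewrite ripC ripZl ripC. Qed.

Lemma rip0l z : rip 0 z = 0.
Proof. by rewrite /rip ip0l. Qed.

Lemma rip0r z : rip z 0 = 0.
Proof. by rewrite /rip ip0r. Qed.

Lemma ip_nm x : <|x, x|> = (nm x ^+ 2)%:C.
Proof. by rewrite -inner_norm nmE rmorphXn. Qed.

Lemma rip_nm x : rip x x = nm x ^+ 2.
Proof. by rewrite /rip ip_nm. Qed.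

(** Real orthogonality to a complex subspace thereby becomes complex orthogonality. *)
Lemma Im_ip x y : complex.Im <|x, y|> = rip x ('i%C *: y).
Proof.
by rewrite /rip ipZr conjE; case: <|x, y|> => u v /=; rewrite mul0r sub0r mulN1r opprK.
Qed.

Lemma ip_self0 x : <|x, x|> = 0 -> x = 0.
Proof. by move/eqP; rewrite dnorm_eq0 => /eqP. Qed.

Lemma nm_sq0 x : nm x ^+ 2 <= 0 -> x = 0.
Proof. by move=> h; apply: nm_le0; have := nm_ge0 x; nra. Qed.

Lemma ip_ext x y : (forall z, <|x, z|> = <|y, z|>) -> x = y.
Proof.
move=> h; apply/eqP; rewrite -subr_eq0; apply/eqP/ip_self0.
by rewrite ipBl h subrr.
Qed.

Lemma nm_sqD x y : nm (x + y) ^+ 2 = nm x ^+ 2 + 2 * rip x y + nm y ^+ 2.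
Proof. by rewrite -!rip_nm !ripDl !ripDr (ripC y x); ring. Qed.

Lemma nm_sqB x y : nm (x - y) ^+ 2 = nm x ^+ 2 - 2 * rip x y + nm y ^+ 2.
Proof. by rewrite nm_sqD nmN ripNr; ring. Qed.

Lemma rip_le x y : rip x y <= nm x * nm y.
Proof.
have [->|x0] := eqVneq x 0; first by rewrite rip0l nm0 mul0r.
have nx : 0 < nm x.
  rewrite lt_neqAle nm_ge0 andbT eq_sym; apply: contraNneq x0 => h.
  by apply/eqP/nm_le0; rewrite h.
rewrite -(ler_pM2l nx) -subr_ge0.
(* Expanded, this square is 2 |x| |y| (|x| |y| - [rip x y]). *)
have := sqr_ge0 (nm ((nm y)%:C *: x - (nm x)%:C *: y)).
rewrite nm_sqB !nmZr ripZl ripZr !ger0_norm ?nm_ge0// => h.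
have [->|y0] := eqVneq y 0; first by rewrite rip0r nm0 !mulr0 subr0.
have ny : 0 < nm y.
  rewrite lt_neqAle nm_ge0 andbT eq_sym; apply: contraNneq y0 => e.
  by apply/eqP/nm_le0; rewrite e.
have : 0 <= nm y * (nm x * (nm x * nm y) - nm x * rip x y) by nra.
by rewrite pmulr_rge0.
Qed.

Lemma cauchy_schwarz x y : cn <|x, y|> <= nm x * nm y.
Proof.
(* With this factor the inner product becomes the real number |<x, y>|^2. *)
have := rip_le (Num.conj <|x, y|> *: x) y.
rewrite nmZ cn_conj /rip ipZl.
have -> : complex.Re (Num.conj <|x, y|> * <|x, y|>) = cn <|x, y|> ^+ 2.
  by rewrite mulrC -normCK cnE -rmorphXn.
rewrite -mulrA expr2.
have := cn_ge0 <|x, y|>; rewrite le_eqVlt => /orP[/eqP<- _|h].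
  by rewrite mulr_ge0 ?nm_ge0.
by rewrite ler_pM2l.
Qed.

Lemma nm_le_sq x y : nm x ^+ 2 <= nm y ^+ 2 -> nm x <= nm y.
Proof. by rewrite ler_pXn2r ?nnegrE ?nm_ge0. Qed.

Definition sym (f : H -> H) := forall x y, <|f x, y|> = <|x, f y|>.

(** An everywhere defined adjoint already forces linearity ([adjD], [adjZ]), so operators can stay
    plain functions, as produced by [choice]. *)
Definition adj (f g : H -> H) := forall x y, <|f x, y|> = <|x, g y|>.

Lemma adj_sym (f g : H -> H) : adj f g -> adj g f.
Proof. by move=> fg x y; rewrite ipC -fg -ipC. Qed.

Lemma adjD f g x y : adj f g -> f (x + y) = f x + f y.
Proof. by move=> fg; apply: ip_ext => z; rewrite ipDl !fg ipDl. Qed.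

Lemma adjZ f g a x : adj f g -> f (a *: x) = a *: f x.
Proof. by move=> fg; apply: ip_ext => z; rewrite ipZl !fg ipZl. Qed.

Lemma adjN f g x : adj f g -> f (- x) = - f x.
Proof. by move=> fg; apply: ip_ext => z; rewrite ipNl !fg ipNl. Qed.

Lemma adjB f g x y : adj f g -> f (x - y) = f x - f y.
Proof. by move=> fg; rewrite (adjD _ _ fg) (adjN _ fg). Qed.

Lemma adj0 f g : adj f g -> f 0 = 0.
Proof. by move=> fg; apply: ip_ext => z; rewrite fg !ip0l. Qed.

Lemma adj_rip f g x y : adj f g -> rip (f x) y = rip x (g y).
Proof. by move=> fg; rewrite /rip fg. Qed.

End InnerProduct.

(** * Projection onto closed subspaces *)

Section Projection.
Variables (R : realType) (H : hilbert R).
Implicit Types (x y z : H) (p k : H * H) (K : set (H * H)) (D : set H).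

Lemma le_eps (x y C : R) : (forall e, 0 < e -> x <= y + e * C) -> x <= y.
Proof.
move=> h; apply/ler_addgt0Pr => e e0.
have C0 : 0 < `|C| + 1 by rewrite ltr_wpDl.
have := h (e / (`|C| + 1)) (divr_gt0 e0 C0) => /le_trans; apply.
rewrite lerD2l mulrAC ler_pdivrMr// ler_pM2l//.
by have := ler_norm C; lra.
Qed.

Definition near_pt K p : Prop :=
  forall e : R, 0 < e ->
    exists2 k, K k & nm (k.1 - p.1) < e /\ nm (k.2 - p.2) < e.

Lemma nbhs_pair p (A : set (H * H)) :
  nbhs p A <-> exists2 e : R, 0 < e &
    forall k, nm (k.1 - p.1) < e -> nm (k.2 - p.2) < e -> A k.
Proof.
split.
  move=> [[A1 A2] /= [/nbhs_nm[e1 e10 h1] /nbhs_nm[e2 e20 h2]] h].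
  exists (Num.min e1 e2); first by rewrite lt_min e10.
  move=> k; rewrite !lt_min => /andP[a1 a2] /andP[a3 a4].
  by apply: h; split; [apply: h1|apply: h2].
move=> [e e0 h].
exists ([set y | nm (y - p.1) < e], [set y | nm (y - p.2) < e]).
  by split; apply/nbhs_nm; exists e.
by move=> k [/= ? ?]; apply: h.
Qed.

Lemma closureP K p : closure K p <-> near_pt K p.
Proof.
split=> [cl e e0|np B /nbhs_pair[e e0 h]].
  have [|k [Kk [h1 h2]]] := cl [set k | nm (k.1 - p.1) < e /\ nm (k.2 - p.2) < e].
    by apply/nbhs_pair; exists e.
  by exists k.
have [k Kk [h1 h2]] := np _ e0.
by exists k; split=> //; apply: h.
Qed.

Lemma closedP K : closed K <-> forall p, near_pt K p -> K p.
Proof. by split=> h p; [move/closureP/h|move/closureP/h]. Qed.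

Lemma subspaceP (V : lmodType R[i]) (D : set V) : lin_subspace D <->
  D 0 /\ (forall a (x y : V), D x -> D y -> D (a *: x + y)).
Proof.
split=> [[d0 dl]|[d0 dl]].
  split; first by move: d0; rewrite inE.
  by move=> a x y Dx Dy; have := dl a x y; rewrite !inE; apply.
by split; [rewrite inE|move=> a x y; rewrite !inE; apply: dl].
Qed.

Lemma subspaceD (V : lmodType R[i]) (D : set V) (x y : V) : lin_subspace D ->
  D x -> D y -> D (x + y).
Proof. by move=> /subspaceP[_ h] dx dy; rewrite -[x]scale1r; apply: h. Qed.

Lemma subspaceZ (V : lmodType R[i]) (D : set V) a (x : V) : lin_subspace D ->
  D x -> D (a *: x).
Proof. by move=> /subspaceP[d0 h] dx; rewrite -[_ *: _]addr0; apply: h. Qed.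

Lemma subspaceB (V : lmodType R[i]) (D : set V) (x y : V) : lin_subspace D ->
  D x -> D y -> D (x - y).
Proof.
by move=> h dx dy; rewrite -scaleN1r; apply: subspaceD => //; apply: subspaceZ.
Qed.

(** First-order condition at a minimum: moving by t k' and letting n tend to infinity gives 0 <= t^2
    Q - 2 t b for every real t, hence b = 0. *)
Lemma min_seq_orth p k (kn : nat -> H * H) (k' : H * H) :
  (forall e : R, 0 < e -> exists n0, forall n, (n0 <= n)%N ->
     nm ((kn n).1 - k.1) < e /\ nm ((kn n).2 - k.2) < e) ->
  (forall e : R, 0 < e -> exists n0, forall n, (n0 <= n)%N -> forall t : R,
     nm (p.1 - (kn n).1) ^+ 2 + nm (p.2 - (kn n).2) ^+ 2 <=
     nm (p.1 - ((kn n).1 + t%:C *: k'.1)) ^+ 2 +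
     nm (p.2 - ((kn n).2 + t%:C *: k'.2)) ^+ 2 + e) ->
  rip (p.1 - k.1) k'.1 + rip (p.2 - k.2) k'.2 = 0.
Proof.
move=> kk kmin; set b := (X in X = _).
pose Q := nm k'.1 ^+ 2 + nm k'.2 ^+ 2.
pose M := nm k'.1 + nm k'.2.
have Q0 : 0 <= Q by rewrite addr_ge0 ?sqr_ge0.
have key (t : R) : 0 <= t ^+ 2 * Q - 2 * t * b.
  apply: (@le_eps _ _ (1 + 2 * `|t| * M)) => e e0.
  have [n0 h0] := kk _ e0; have [n1 h1] := kmin _ e0.
  pose n := maxn n0 n1.
  have [a1 a2] := h0 n (leq_maxl _ _).
  have := h1 n (leq_maxr _ _) t.
  have E (x y z : H) : nm (x - (y + t%:C *: z)) ^+ 2 =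
      nm (x - y) ^+ 2 - 2 * t * rip (x - y) z + t ^+ 2 * nm z ^+ 2.
    by rewrite opprD addrA (nm_sqB (x - y)) ripZr nmZr exprMn real_normK ?num_real//; ring.
  rewrite !E.
  have F (x y z w : H) : nm (y - z) < e ->
    - t * rip (x - y) w <= - t * rip (x - z) w + e * `|t| * nm w.
    move=> yz; have -> : x - y = x - z - (y - z).
      by rewrite opprB addrA subrK.
    rewrite ripBl mulrBr lerD2l mulNr opprK -ripZl.
    apply: le_trans (rip_le _ _) _; rewrite nmZr [e * _]mulrC.
    apply: ler_wpM2r; first exact: nm_ge0.
    by apply: ler_wpM2l => //; exact: ltW.
  have := F p.1 (kn n).1 k.1 k'.1 a1; have := F p.2 (kn n).2 k.2 k'.2 a2.
  rewrite /b /Q /M.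
  by lra.
(* Near the minimiser t = b / Q; the added 1 covers k' = 0. *)
have := key (b / (Q + 1)).
have Q1 : 0 < Q + 1 by lra.
have -> : (b / (Q + 1)) ^+ 2 * Q - 2 * (b / (Q + 1)) * b
   = - (b ^+ 2 * (Q + 2)) / (Q + 1) ^+ 2 by field; lra.
rewrite pmulr_lge0 ?invr_gt0 ?exprn_gt0// => h.
have : b ^+ 2 <= 0 by nra.
by move=> h2; apply/eqP; rewrite -sqrf_eq0; apply/eqP/le_anti; rewrite h2 sqr_ge0.
Qed.

Lemma archi_inv (e : R) : 0 < e -> exists n0 : nat, forall n, (n0 <= n)%N ->
  n.+1%:R^-1 < e.
Proof.
move=> e0; exists (Num.truncn e^-1) => n n0n.
rewrite invf_plt ?posrE//.
apply: (lt_le_trans (truncnS_gt _)).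
by rewrite ler_nat ltnS.
Qed.

(** Stated in H * H because it is applied to graphs; a subspace of H is embedded with second
    component 0. *)
Lemma projection K p : lin_subspace K -> closed K -> exists2 k, K k &
  forall k', K k' -> <|p.1 - k.1, k'.1|> + <|p.2 - k.2, k'.2|> = 0.
Proof.
move=> Ks /closedP Kc.
have K0 : K 0 by case/subspaceP : Ks.
pose d k : R := nm (p.1 - k.1) ^+ 2 + nm (p.2 - k.2) ^+ 2.
pose E := d @` K.
have hE : has_inf E.
  by split; [exists (d 0), 0|exists 0 => _ [k Kk <-]; rewrite addr_ge0 ?sqr_ge0].
pose m := inf E.
have mle k : K k -> m <= d k.
  by move=> Kk; apply: ge_inf; [case: hE|exists k].
have /choice[kn knP] (n : nat) : exists k, K k /\ d k < m + n.+1%:R^-1.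
  have [_ [k Kk <-] h] := @inf_adherent _ E n.+1%:R^-1 ltac:(by rewrite invr_gt0) hE.
  by exists k.
(* Parallelogram law: the midpoint of k and l lies in K, so its squared distance to p is at least
   m. *)
have para k l : K k -> K l ->
  nm (k.1 - l.1) ^+ 2 + nm (k.2 - l.2) ^+ 2 <= 2 * d k + 2 * d l - 4 * m.
  move=> Kk Kl; have := mle _ (subspaceZ (2^-1)%:C Ks (subspaceD Ks Kk Kl)).
  rewrite /d /=.
  have P (x y z : H) : nm (y - z) ^+ 2 =
    2 * nm (x - y) ^+ 2 + 2 * nm (x - z) ^+ 2
      - 4 * nm (x - (2^-1)%:C *: (y + z)) ^+ 2.
    rewrite (nm_sqB x (_ *: _)) !nm_sqB !ripZr !ripDr nmZr exprMn real_normK ?num_real// nm_sqD.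
    by field.
  by rewrite (P p.1 k.1) (P p.2 k.2); lra.
have small x y (e : R) : 0 < e -> nm x ^+ 2 + nm y ^+ 2 < e ^+ 2 -> nm x < e /\ nm y < e.
  move=> e0 h; have nx := nm_ge0 x; have ny := nm_ge0 y.
  by split; rewrite ltNge; apply/negP => h'; nra.
have cau (e : R) : 0 < e -> exists n0, forall i j, (n0 <= i)%N -> (n0 <= j)%N ->
   nm ((kn i).1 - (kn j).1) < e /\ nm ((kn i).2 - (kn j).2) < e.
  move=> e0; have [n0 h] := archi_inv (ltac:(nra) : 0 < e ^+ 2 / 4).
  exists n0 => i j n0i n0j; apply: small => //.
  have [Ki di] := knP i; have [Kj dj] := knP j.
  apply: (le_lt_trans (para _ _ Ki Kj)).
  have := h _ n0i; have := h _ n0j; move: di dj.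
  by move: (i.+1%:R^-1) (j.+1%:R^-1) => a b; lra.
have [k1 hk1] : exists x, lim_seq (fun n => (kn n).1) x.
  by apply: cauchy_nm_lim => e /cau[n0 h]; exists n0 => i j hi hj; case: (h _ _ hi hj).
have [k2 hk2] : exists x, lim_seq (fun n => (kn n).2) x.
  by apply: cauchy_nm_lim => e /cau[n0 h]; exists n0 => i j hi hj; case: (h _ _ hi hj).
have lim (e : R) : 0 < e -> exists n0, forall n, (n0 <= n)%N ->
   nm ((kn n).1 - k1) < e /\ nm ((kn n).2 - k2) < e.
  move=> e0; have [n1 h1] := hk1 _ e0; have [n2 h2] := hk2 _ e0.
  exists (maxn n1 n2) => n; rewrite geq_max => /andP[a1 a2].
  by split; [apply: h1|apply: h2].
exists (k1, k2).
  apply: Kc => e /lim[n0 h]; exists (kn n0); first by case: (knP n0).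
  exact: h.
have orth k' : K k' -> rip (p.1 - k1) k'.1 + rip (p.2 - k2) k'.2 = 0.
  move=> Kk'; apply: (@min_seq_orth p (k1, k2) kn k' lim) => e /archi_inv[n0 h].
  exists n0 => n n0n t; have [Kn dn] := knP n.
  have := mle _ (subspaceD Ks Kn (subspaceZ t%:C Ks Kk')).
  by have := h _ n0n; move: dn; rewrite /d /=; move: (n.+1%:R^-1) => a; lra.
move=> k' Kk' /=; apply/eqP; rewrite eq_complex; apply/andP; split; apply/eqP.
  by rewrite ReD; exact: orth.
(* The imaginary part is the real identity for i k'. *)
have := orth _ (subspaceZ 'i%C Ks Kk').
by rewrite /= -!Im_ip; case: <|_, k'.1|> => ? ?; case: <|_, k'.2|>.
Qed.

End Projection.

(** * Adjoints and von Neumann's resolvent *)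

Section Operators.
Variables (R : realType) (H : hilbert R).
Implicit Types (x y z : H) (p k : H * H) (K T A : graph H) (D : set H).

Lemma near_pt_subspace K : lin_subspace K -> lin_subspace (near_pt K).
Proof.
move=> Ks; apply/subspaceP; split=> [e e0|a p q hp hq e e0].
  by exists 0; [case/subspaceP : Ks|rewrite subrr nm0].
have a1 : 0 < cn a + 1 by have := cn_ge0 a; lra.
have e1 : 0 < e / (cn a + 1) by rewrite divr_gt0.
have [k Kk [k1 k2]] := hp _ e1; have [l Kl [l1 l2]] := hq _ e1.
exists (a *: k + l); first by case/subspaceP : Ks => _; apply.
have E (x y z w : H) : nm (x - z) < e / (cn a + 1) -> nm (y - w) < e / (cn a + 1) ->
    nm (a *: x + y - (a *: z + w)) < e.
  move=> xz yw; rewrite opprD addrACA -scalerBr.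
  apply: (le_lt_trans (nmD _ _)); rewrite nmZ.
  have -> : e = cn a * (e / (cn a + 1)) + e / (cn a + 1) by field; lra.
  by rewrite ler_ltD// ler_wpM2l ?cn_ge0// ltW.
by split; apply: E.
Qed.

Lemma near_pt_sub K : K `<=` near_pt K.
Proof. by move=> p Kp e e0; exists p => //; rewrite !subrr nm0. Qed.

Lemma near_pt_closed K : closed (near_pt K).
Proof.
have -> : near_pt K = closure K.
  by apply/seteqP; split=> p /closureP.
exact: closed_closure.
Qed.

Lemma cn_eps (a : R[i]) (C : R) : (forall e, 0 < e -> cn a <= e * C) -> a = 0.
Proof. by move=> h; apply: cn_le0; apply: (@le_eps _ _ _ C) => e /h; rewrite add0r. Qed.

Lemma denseP D : dense D <->
  forall x (e : R), 0 < e -> exists2 d, D d & nm (d - x) < e.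
Proof.
split=> [Dd x e e0|h O [x Ox] Oo].
  have [|d [/= Od Dd']] := Dd [set y | nm (y - x) < e]°%classic _ (@open_interior _ _).
    by exists x; apply/nbhs_nm; exists e.
  exists d => //; apply: (interior_subset Od).
have /nbhs_nm[e e0 hO] : nbhs x O by apply: open_nbhs_nbhs.
by have [d Dd dx] := h x e e0; exists d; split=> //; apply: hO.
Qed.

Lemma dense_orth D x : dense D -> (forall d, D d -> <|x, d|> = 0) -> x = 0.
Proof.
move=> /denseP Dd h; apply: ip_self0; apply: (@cn_eps _ (nm x)) => e /(Dd x)[d Dx dx].
rewrite -[<|x, x|>]subr0 -(h _ Dx) -ipBr; apply: (le_trans (cauchy_schwarz _ _)).
by rewrite mulrC ler_wpM2r ?nm_ge0// nmC ltW.
Qed.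

Lemma orth_dense D : lin_subspace D ->
  (forall x, (forall d, D d -> <|x, d|> = 0) -> x = 0) -> dense D.
Proof.
move=> Ds Do; apply/denseP => x.
pose K : set (H * H) := [set p | D p.1 /\ p.2 = 0].
have Ks : lin_subspace K.
  case/subspaceP : (Ds) => D0 Dl; apply/subspaceP; split=> // a p q [p1 p2] [q1 q2].
  by split=> /=; [apply: Dl|rewrite p2 q2 scaler0 addr0].
have [k Kk hk] := projection (x, 0) (near_pt_subspace Ks) (@near_pt_closed K).
have /eqP : x - k.1 = 0.
  apply: Do => d Dd; have := hk (d, 0); rewrite /= ip0r addr0; apply.
  exact: near_pt_sub.
rewrite subr_eq0 => /eqP -> e /Kk[l [Dl _] [l1 _]].
by exists l.1.
Qed.

Lemma riesz (L : H -> R[i]) (C : R) :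
  (forall a x y, L (a *: x + y) = Num.conj a * L x + L y) ->
  (forall x, cn (L x) <= C * nm x) -> exists g, forall y, L y = <|g, y|>.
Proof.
move=> Ll Lb.
have L0 : L 0 = 0.
  by have := Ll 1 0 0; rewrite scale1r addr0 conjC1 mul1r => /eqP;
    rewrite -subr_eq0 opprD addNKr oppr_eq0 => /eqP.
have LB x y : L (x - y) = L x - L y.
  by rewrite addrC -scaleN1r Ll rmorphN1 mulN1r addrC.
pose K : set (H * H) := [set p | L p.1 = 0 /\ p.2 = 0].
have Ks : lin_subspace K.
  apply/subspaceP; split=> // a p q [p1 p2] [q1 q2].
  by split=> /=; [rewrite Ll p1 q1 mulr0 addr0|rewrite p2 q2 scaler0 addr0].
have Kc : closed K.
  apply/closedP => p hp; split.
    apply: (@cn_eps _ `|C|) => e /hp[k [k1 _] [k2 _]].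
    rewrite -[L p.1]subr0 -k1 -LB; apply: (le_trans (Lb _)).
    apply: (@le_trans _ _ (`|C| * nm (p.1 - k.1))).
      by rewrite ler_wpM2r ?nm_ge0// ler_norm.
    by rewrite mulrC ler_wpM2r// nmC ltW.
  apply: nm_le0; apply: (@le_eps _ _ _ 1) => e /hp[k [_ k1] [_ k2]].
  by rewrite -nmN -sub0r -k1 add0r mulr1 ltW.
have [L00|/existsNP[x0 Lx0]] := pselect (forall x, L x = 0).
  by exists 0 => y; rewrite ip0l L00.
have [k [k1 _] hk] := projection (x0, 0) Ks Kc.
pose z := x0 - k.1.
have Lz : L z != 0 by rewrite /z LB k1 subr0; apply/eqP.
have zz : <|z, z|> != 0.
  by rewrite dnorm_eq0; apply: contraNneq Lz => ->; rewrite L0.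
exists ((L z / <|z, z|>) *: z) => y.
(* The conjugate compensates for antilinearity: it puts [- a *: z + y] in the kernel of [L], to
   which z is orthogonal. *)
pose a := Num.conj (L y / L z).
have aE : Num.conj (- a) = - (L y / L z) by rewrite raddfN /= /a conjCK.
have : <|z, - a *: z + y|> = 0.
  have := hk (- a *: z + y, 0); rewrite /= ip0r addr0; apply; split=> //=.
  by rewrite Ll aE mulNr divfK// addNr.
rewrite ipDr ipZr aE ipZl mulNr => /eqP.
rewrite addrC subr_eq0 => /eqP ->.
by field; rewrite Lz.
Qed.

Lemma adjoint_subspace T : lin_subspace (adjoint T).
Proof.
apply/subspaceP; split=> [x y _|a p q hp hq x y Txy] /=; first by rewrite !ip0r.
by rewrite !ipDr !ipZr (hp _ _ Txy) (hq _ _ Txy).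
Qed.

Lemma adjoint_closed T : closed (adjoint T).
Proof.
apply/closedP => p hp x y Txy; apply/eqP; rewrite -subr_eq0; apply/eqP.
apply: (@cn_eps _ (nm y + nm x)) => e /hp[k Tk [k1 k2]].
have -> : <|y, p.1|> - <|x, p.2|> = <|x, k.2 - p.2|> - <|y, k.1 - p.1|>.
  by rewrite !ipBr (Tk _ _ Txy); ring.
apply: (le_trans (cnD _ _)); rewrite cnN mulrDr addrC lerD//.
  apply: (le_trans (cauchy_schwarz _ _)).
  by rewrite mulrC ler_wpM2r ?nm_ge0// ltW.
apply: (le_trans (cauchy_schwarz _ _)).
by rewrite mulrC ler_wpM2r ?nm_ge0// ltW.
Qed.

Lemma adjoint_operator T : dense (dom T) -> is_operator (adjoint T).
Proof.
move=> Td; split; first exact: adjoint_subspace.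
move=> x y z hy hz; apply/eqP; rewrite -subr_eq0; apply/eqP.
apply: dense_orth Td _ => d [w Tdw].
by rewrite ipC ipBr -(hy _ _ Tdw) -(hz _ _ Tdw) subrr conjC0.
Qed.

Lemma adjointP T x y u v : T (x, y) -> adjoint T (u, v) -> <|y, u|> = <|x, v|>.
Proof. by move=> Txy; apply. Qed.

Lemma op_sub T x y x' y' : is_operator T -> T (x, y) -> T (x', y') ->
  T (x - x', y - y').
Proof. by move=> [Ts _] h h'; exact: (subspaceB Ts h h'). Qed.

Lemma op_lin T a x y x' y' : is_operator T -> T (x, y) -> T (x', y') ->
  T (a *: x + x', a *: y + y').
Proof. by move=> [/subspaceP[_ Ts] _] h h'; exact: (Ts a _ _ h h'). Qed.

Lemma op_zero T : is_operator T -> T (0, 0).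
Proof. by case=> /subspaceP[]. Qed.

(* [Q] is the resolvent [(1 + A)^-1] of a positive self-adjoint [A]. *)
Definition resolvent_of A (Q : H -> H) : Prop :=
  [/\ sym Q, (forall x, nm (Q x) <= nm x), (forall x, nm (x - Q x) <= nm x),
      (forall x, Q x = 0 -> x = 0) &
      forall u w, A (u, w) <-> exists2 h, u = Q h & w = h - Q h].

(** Project (h, 0) onto the graph of T, obtaining (Q h, v). Orthogonality of (h - Q h, - v) to the
    graph says exactly T* v = h - Q h, that is, (1 + T* T) Q h = h. *)
Lemma von_neumann T : is_operator T -> closed_op T -> dense (dom T) ->
  exists2 Q, resolvent_of (op_comp (adjoint T) T) Q &
    forall h, exists2 v, T (Q h, v) & adjoint T (v, h - Q h).
Proof.
move=> To Tc Td; have As := adjoint_operator Td.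
have /choice[f hf] h : exists k : H * H, T k /\ adjoint T (k.2, h - k.1).
  have [k Tk hk] := projection (h, 0) (proj1 To) Tc.
  exists k; split=> // x y Txy; have := hk _ Txy; rewrite /= sub0r ipNl => /eqP.
  by rewrite subr_eq0 => /eqP e; rewrite ipC -e -ipC.
pose Q h := (f h).1; pose v h := (f h).2.
have Tf h : T (Q h, v h) by case: (hf h); rewrite [f h]surjective_pairing.
have Tg h : adjoint T (v h, h - Q h) by case: (hf h).
have vv h g : <|v h, v g|> = <|Q h, g - Q g|> by exact: adjointP (Tf h) (Tg g).
have est h : rip (Q h) (h - Q h) = nm (v h) ^+ 2 by rewrite /rip -vv ip_nm.
have dec h : nm h ^+ 2 = nm (Q h) ^+ 2 + 2 * nm (v h) ^+ 2 + nm (h - Q h) ^+ 2.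
  by rewrite -est -nm_sqD addrC subrK.
exists Q; last by move=> h; exists (v h).
split.
- move=> h g; rewrite -[g in LHS](subrK (Q g)) addrC ipDr -vv.
  by rewrite -[h in RHS](subrK (Q h)) addrC ipDl (ipC (h - _)) -vv -ipC.
- move=> h; apply: nm_le_sq; rewrite (dec h).
  by have := sqr_ge0 (nm (v h)); have := sqr_ge0 (nm (h - Q h)); lra.
- move=> h; apply: nm_le_sq; rewrite (dec h).
  by have := sqr_ge0 (nm (v h)); have := sqr_ge0 (nm (Q h)); lra.
- move=> h Qh; have := Tf h; rewrite Qh => Tv.
  have v0 : v h = 0 by apply: (proj2 To) Tv (op_zero To).
  apply: (dense_orth Td) => d [w Tdw].
  have := adjointP Tdw (Tg h); rewrite v0 Qh subr0 ip0r => e.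
  by rewrite ipC -e conjC0.
- move=> u w; split=> [[y [/= Tuy Ayw]]|[h -> ->]]; last first.
    by exists (v h); split; [apply: Tf|apply: Tg].
  pose h := u + w.
  have T1 := op_sub To Tuy (Tf h); have A1 := op_sub As Ayw (Tg h).
  have wE : w - (h - Q h) = - (u - Q h).
    by rewrite /h opprB (addrC u) opprD !addrA (addrC w) addrK opprB.
  (* Injectivity of 1 + T* T: the difference d = u - Q h satisfies T* T d = - d, so |T d|^2 = -
     |d|^2. *)
  have := adjointP T1 A1; rewrite wE ipNr !ip_nm -rmorphN => /(congr1 (@complex.Re R)) /= e.
  have uE : u - Q h = 0.
    by apply: nm_sq0; have := sqr_ge0 (nm (y - v h)); lra.
  move/eqP: uE; rewrite subr_eq0 => /eqP uE.
  by exists h => //; rewrite -uE /h addrC addKr.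
Qed.

End Operators.

Ltac vec := apply: ip_ext => ?; rewrite ?(ipDl, ipNl, ipZl, ip0l); first [ring | by field].

(** * Square roots of bounded operators *)

Section BoundedSqrt.
Variables (R : realType) (H : hilbert R).
Implicit Types (x y z : H) (f g h : H -> H).

(* Iterating [Y := (Q + Y^2) / 2] from [0], where [Q = 1 - f], converges to
   [1 - sqrt f]; the same iteration on numbers, started with [Q = 1], has
   limit [1] and bounds the operator norms. *)
Fixpoint sqrt_iter f (n : nat) x : H :=
  if n is m.+1 then 2^-1 *: (x - f x + sqrt_iter f m (sqrt_iter f m x)) else 0.

Fixpoint iter_bound (n : nat) : R :=
  if n is m.+1 then (1 + iter_bound m ^+ 2) / 2 else 0.

Lemma cn_half : cn (2^-1 : R[i]) = 2^-1.
Proof.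
have -> : (2^-1 : R[i]) = (2^-1)%:C by rewrite fmorphV rmorph_nat.
by rewrite cn_real ger0_norm// invr_ge0.
Qed.

Lemma iter_bound_itv n : 0 <= iter_bound n /\ iter_bound n <= 1.
Proof. by elim: n => [|n [h1 h2]] /=; [split; lra|split; nra]. Qed.

(** For d = 1 - [iter_bound n] the recursion is d |-> d - d^2 / 2, which increases on [0, 1] and
    sends 2 / (n + 2) below 2 / (n + 3). *)
Lemma iter_bound_le n : 1 - iter_bound n <= 2 / (n.+1%:R + 1).
Proof.
elim: n => [|n IH] /=; first by rewrite subr0 ler_pdivlMr; lra.
have [h1 h2] := iter_bound_itv n.
have -> : 1 - (1 + iter_bound n ^+ 2) / 2 =
  (1 - iter_bound n) - (1 - iter_bound n) ^+ 2 / 2 by field.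
rewrite -[n.+2%:R]natr1; move: IH; set s : R := n.+1%:R.
have s0 : 0 < s by rewrite ltr0n.
set d := 1 - iter_bound n => IH.
have d0 : 0 <= d by rewrite /d; lra.
set k := 2 / (s + 1) in IH *.
have k1 : k <= 1.
  by rewrite /k ler_pdivrMr; [have : (1 : R) <= s by rewrite ler1n|]; lra.
have : d - d ^+ 2 / 2 <= k - k ^+ 2 / 2.
  have := mulr_ge0 (ltac:(lra) : 0 <= k - d) (ltac:(lra) : 0 <= 2 - k - d).
  lra.
move=> /le_trans; apply.
rewrite -subr_ge0.
have -> : 2 / (s + 1 + 1) - (k - k ^+ 2 / 2) = 2 / ((s + 1) ^+ 2 * (s + 1 + 1)).
  by rewrite /k; field; apply/andP; split; lra.
by rewrite divr_ge0// mulr_ge0 ?exprn_ge0; lra.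
Qed.

Section Iteration.
Variable f : H -> H.
Hypothesis fs : sym f.
Hypothesis fc : forall x, nm (x - f x) <= nm x.

Let Y := sqrt_iter f.

Lemma sqrt_iter_sym n : sym (Y n).
Proof.
elim: n => [|n IH] x y; first by rewrite ip0l ip0r.
rewrite /Y /= -/Y ipZl ipZr !ipDl !ipDr ipNl ipNr fs !IH.
by rewrite fmorphV rmorph_nat.
Qed.

Lemma sqrt_iter_comm g h n x : adj g h -> (forall x, g (f x) = f (g x)) ->
  g (Y n x) = Y n (g x).
Proof.
move=> gh gf; elim: n x => [|n IH] x; first exact: adj0 gh.
by rewrite /Y /= -/Y (adjZ _ _ gh) (adjD _ _ gh) (adjB _ _ gh) gf !IH.
Qed.

Lemma sqrt_iter_commute m n x : Y m (Y n x) = Y n (Y m x).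
Proof.
apply: sqrt_iter_comm; first exact: sqrt_iter_sym.
by move=> z; apply/esym/sqrt_iter_comm.
Qed.

Lemma sqrt_iter_bound n x : nm (Y n x) <= iter_bound n * nm x.
Proof.
elim: n x => [|n IH] x; first by rewrite nm0 mul0r.
rewrite /Y /= -/Y nmZ cn_half.
have := nmD (x - f x) (Y n (Y n x)); have := fc x.
have := IH (Y n x); have := IH x; have [] := iter_bound_itv n.
set b := iter_bound n; have := nm_ge0 (Y n x).
move: (nm (Y n x)) => u u0 b0 b1 h1 h2 h3 h4; nra.
Qed.

(** As the iterates commute, Y_(n+2) - Y_(n+1) = (Y_(n+1) + Y_n) (Y_(n+1) - Y_n) / 2; the numbers
    [iter_bound n] obey the same identity, so the estimate propagates. *)
Lemma sqrt_iter_step n x :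
  nm (Y n.+1 x - Y n x) <= (iter_bound n.+1 - iter_bound n) * nm x.
Proof.
elim: n x => [|n IH] x.
  rewrite /Y /= subr0 addr0 nmZ cn_half.
  by have := fc x; lra.
have -> : Y n.+2 x - Y n.+1 x =
    2^-1 *: (Y n.+1 (Y n.+1 x - Y n x) + Y n (Y n.+1 x - Y n x)).
  rewrite !(adjB _ _ (@sqrt_iter_sym _)) (sqrt_iter_commute n.+1 n x).
  have E m z : Y m.+1 z = 2^-1 *: (z - f z + Y m (Y m z)) by [].
  by rewrite (E n.+1) {2}(E n) -/(Y n.+1 x); vec.
rewrite nmZ cn_half.
apply: le_trans (ler_wpM2l _ (nmD _ _)) _; first by lra.
set z := Y n.+1 x - Y n x.
have := sqrt_iter_bound n.+1 z; have := sqrt_iter_bound n z.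
have := IH x; rewrite -/z.
have [a0 _] := iter_bound_itv n; have [b0 _] := iter_bound_itv n.+1.
have -> : iter_bound n.+2 - iter_bound n.+1 =
  2^-1 * (iter_bound n.+1 + iter_bound n) * (iter_bound n.+1 - iter_bound n).
  by rewrite [iter_bound n.+2]/= [in RHS]/= /=; field.
move: (iter_bound n) (iter_bound n.+1) a0 b0 => a b a0 b0 h1 h2 h3.
have : (a + b) * nm z <= (a + b) * ((b - a) * nm x).
  by apply: ler_wpM2l => //; lra.
lra.
Qed.

Lemma sqrt_iter_cauchy m n x : (n <= m)%N ->
  nm (Y m x - Y n x) <= (iter_bound m - iter_bound n) * nm x.
Proof.
elim: m => [|m IH]; first by rewrite leqn0 => /eqP->; rewrite !subrr nm0 mul0r.
rewrite leq_eqVlt => /predU1P[->|/IH h]; first by rewrite !subrr nm0 mul0r.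
have := nm_tri (Y m.+1 x) (Y m x) (Y n x); have := sqrt_iter_step m x.
lra.
Qed.

Lemma sqrt_iter_lim x : exists y, lim_seq (Y ^~ x) y.
Proof.
apply: cauchy_nm_lim => e e0.
have x1 : 0 < nm x + 1 by have := nm_ge0 x; lra.
have [n0 hn0] := archi_inv (ltac:(by rewrite divr_gt0//; lra) : 0 < e / (2 * (nm x + 1))).
exists n0.
have W m n : (n0 <= n)%N -> (n <= m)%N -> nm (Y m x - Y n x) < e.
  move=> n0n nm'; apply: (le_lt_trans (sqrt_iter_cauchy x nm')).
  have := hn0 _ n0n; have := iter_bound_le n; have [_ h1] := iter_bound_itv m.
  have : (2 : R) / (n.+1%:R + 1) <= 2 * n.+1%:R^-1.
    have p : 0 < n.+1%:R + 1 :> R by rewrite ltr_wpDl.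
    by rewrite ler_wpM2l// lef_pV2 ?posrE ?ltr0n// lerDl.
  move: (2 / (n.+1%:R + 1)) (n.+1%:R^-1) => a b h2 h3.
  rewrite ltr_pdivlMr; last by lra.
  move=> h4; have := nm_ge0 x => h5.
  apply: (@le_lt_trans _ _ ((2 * b) * (nm x + 1))); last by lra.
  apply: (@le_trans _ _ (2 * b * nm x)); first by apply: ler_wpM2r => //; lra.
  have [_ h6] := iter_bound_itv n.
  by apply: ler_wpM2l; lra.
move=> m n mn nn; have [h|/ltnW h] := leqP n m; first exact: W.
by rewrite nmC; apply: W.
Qed.

(** In the commutation clause the adjoint of [g] replaces continuity: the limit is taken inside an
    inner product, after [g] has moved to the fixed vector [h y]. *)
Lemma bounded_sqrt : exists c : H -> H,
  [/\ sym c, (forall x, nm (x - c x) <= nm x), (forall x, c (c x) = f x) &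
      forall g h, adj g h -> (forall x, g (f x) = f (g x)) ->
        forall x, g (c x) = c (g x)].
Proof.
have /choice[Z ZP] := sqrt_iter_lim.
have Zs : sym Z.
  move=> x y; apply/eqP; rewrite -subr_eq0; apply/eqP.
  apply: (@cn_eps _ _ (nm y + nm x)) => e e0.
  have [n1 h1] := ZP x _ e0; have [n2 h2] := ZP y _ e0.
  pose n := maxn n1 n2.
  have {}h1 := h1 n (leq_maxl _ _); have {}h2 := h2 n (leq_maxr _ _).
  have -> : <|Z x, y|> - <|x, Z y|> = <|x, Y n y - Z y|> - <|Y n x - Z x, y|>.
    by rewrite ipBl ipBr sqrt_iter_sym; ring.
  apply: (le_trans (cnD _ _)); rewrite cnN mulrDr addrC lerD//.
    apply: (le_trans (cauchy_schwarz _ _)).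
    by rewrite ler_wpM2r ?nm_ge0// ltW.
  apply: (le_trans (cauchy_schwarz _ _)).
  by rewrite mulrC ler_wpM2r ?nm_ge0// ltW.
have Zg g h : adj g h -> (forall x, g (f x) = f (g x)) -> forall x, g (Z x) = Z (g x).
  move=> gh gf x; apply: ip_ext => y; rewrite gh; apply/eqP; rewrite -subr_eq0; apply/eqP.
  apply: (@cn_eps _ _ (nm (h y) + nm y)) => e e0.
  have [n1 h1] := ZP x _ e0; have [n2 h2] := ZP (g x) _ e0.
  pose n := maxn n1 n2.
  have {}h1 := h1 n (leq_maxl _ _); have {}h2 := h2 n (leq_maxr _ _).
  have -> : <|Z x, h y|> - <|Z (g x), y|> =
      <|Y n (g x) - Z (g x), y|> - <|Y n x - Z x, h y|>.
    by rewrite !ipBl -(sqrt_iter_comm _ _ gh gf) gh; ring.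
  apply: (le_trans (cnD _ _)); rewrite cnN mulrDr addrC lerD//.
    apply: (le_trans (cauchy_schwarz _ _)).
    by rewrite ler_wpM2r ?nm_ge0// ltW.
  apply: (le_trans (cauchy_schwarz _ _)).
  by rewrite ler_wpM2r ?nm_ge0// ltW.
have Yc n x : nm (Y n x) <= nm x.
  apply: (le_trans (sqrt_iter_bound n x)); have := nm_ge0 x.
  by have [] := iter_bound_itv n; nra.
have Zc x : nm (Z x) <= nm x.
  apply: (@le_eps _ _ _ 1) => e e0; have [n /(_ n (leqnn _)) h] := ZP x _ e0.
  have := nm_tri (Z x) (Y n x) 0; rewrite !subr0 nmC.
  by have := Yc n x; lra.
(* The fixed point equation of the iteration; rearranged, it reads (1 - Z)^2 = f. *)
have ZE x : 2 *: Z x = x - f x + Z (Z x).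
  apply/eqP; rewrite -subr_eq0; apply/eqP/nm_le0; apply: (@le_eps _ _ _ 4) => e e0.
  have [n1 h1] := ZP x _ e0; have [n2 h2] := ZP (Z x) _ e0.
  pose n := maxn n1 n2.
  have {}h1' := h1 n.+1 (leq_trans (leq_maxl _ _) (leqnSn _)).
  have {}h1 := h1 n (leq_maxl _ _); have {}h2 := h2 n (leq_maxr _ _).
  have -> : 2 *: Z x - (x - f x + Z (Z x)) =
     - (2 *: (Y n.+1 x - Z x)) + (Y n (Y n x - Z x) + (Y n (Z x) - Z (Z x))).
    have -> : Y n.+1 x = 2^-1 *: (x - f x + Y n (Y n x)) by [].
    by rewrite (adjB _ _ (@sqrt_iter_sym n)); vec.
  have n2E : cn (2 : R[i]) = 2.
    have -> : (2 : R[i]) = 2%:C by rewrite rmorph_nat.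
    by rewrite cn_real ger0_norm.
  rewrite add0r.
  apply: (le_trans (nmD _ _)); rewrite nmN nmZ n2E.
  have := nmD (Y n (Y n x - Z x)) (Y n (Z x) - Z (Z x)).
  by have := Yc n (Y n x - Z x); lra.
exists (fun x => x - Z x); split.
- by move=> x y; rewrite ipBl ipBr Zs.
- by move=> x; rewrite opprB addrC subrK; exact: Zc.
- move=> x; rewrite (adjB _ _ Zs).
  have -> : Z (Z x) = 2 *: Z x - (x - f x) by rewrite ZE addrC addKr.
  by vec.
- by move=> g h gh gf x; rewrite (adjB _ _ gh) (Zg _ _ gh gf).
Qed.

End Iteration.
End BoundedSqrt.

(** * Square roots of unbounded operators *)

Section UnboundedSqrt.
Variables (R : realType) (H : hilbert R).
Implicit Types (x y z : H) (S T A X : graph H) (c s Q : H -> H).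

Lemma sym_real f x : sym f -> <|f x, x|> = (rip (f x) x)%:C.
Proof.
move=> fs; rewrite /rip RRe_real// CrealE; apply/eqP.
by rewrite -ipC -fs.
Qed.

(** The bound on 1 - f, which the iteration consumes, stands in for positivity. Squaring it gives
    positivity back, with a margin that yields f x = 0 from <f x, x> = 0. *)
Lemma near1_pos f x : sym f -> (forall x : H, nm (x - f x) <= nm x) ->
  nm (f x) ^+ 2 <= 2 * rip (f x) x.
Proof.
move=> fs fc; have := fc x; rewrite -(ler_pXn2r (isT : (0 < 2)%N)) ?nnegrE ?nm_ge0//.
by rewrite nm_sqB (ripC x); lra.
Qed.

(** Each root D is compared with the root c found by iteration, which commutes with D. For y = D x -
    c x one has (D + c) y = 0; both <D y, y> and <c y, y> are nonnegative, so c y = D y = 0, and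
    |y|^2 = <x, D y - c y> = 0. *)
Lemma bounded_root_unique C C' : sym C -> sym C' ->
  (forall x : H, nm (C x) <= nm x) -> (forall x, nm (C' x) <= nm x) ->
  (forall x, 0 <= rip (C x) x) -> (forall x, 0 <= rip (C' x) x) ->
  (forall x, C (C x) = C' (C' x)) -> forall x, C x = C' x.
Proof.
move=> Cs Cs' Cc Cc' Cp Cp' CC.
have [|x|c [cs cc cE ccomm]] := @bounded_sqrt _ _ (fun x => C (C x)).
- by move=> x y; rewrite !Cs.
- apply: nm_le_sq; rewrite nm_sqB (ripC x) (adj_rip _ _ Cs) rip_nm.
  have : nm (C (C x)) ^+ 2 <= nm (C x) ^+ 2.
    by rewrite ler_pXn2r ?nnegrE ?nm_ge0.
  by have := sqr_ge0 (nm (C x)); lra.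
suff key D : sym D -> (forall x, 0 <= rip (D x) x) ->
    (forall x, D (D x) = c (c x)) -> forall x, D x = c x.
  by move=> x; rewrite (key C) ?(key C')// => z; rewrite cE// CC.
move=> Ds Dp DD x.
have Dc z : D (c z) = c (D z).
  have DC w : C (C w) = D (D w) by rewrite DD cE.
  by apply: (ccomm D D Ds) => w; rewrite !DC.
pose y := D x - c x.
have e1 : D y + c y = 0.
  rewrite /y (adjB _ _ Ds) (adjB _ _ cs) DD Dc; vec.
have cy0 : c y = 0.
  apply: nm_sq0; have := near1_pos y cs cc; have := Dp y.
  have : rip (D y + c y) y = 0 by rewrite e1 rip0l.
  by rewrite ripDl; lra.
have Dy0 : D y = 0 by move: e1; rewrite cy0 addr0.
apply/eqP; rewrite -subr_eq0 -/y; apply/eqP/ip_self0.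
by rewrite {1}/y ipBl Ds cs Dy0 cy0 ip0r subr0.
Qed.

(* [c] and [s] stand for [(1 + S^2)^(-1/2)] and [S (1 + S^2)^(-1/2)], where
   [S] is a positive self-adjoint operator. *)
Definition cs_pair c s : Prop :=
  [/\ sym c /\ sym s, forall x, s (c x) = c (s x),
      forall x, c (c x) + s (s x) = x, forall x, c x = 0 -> x = 0 &
      forall x, 0 <= rip (s x) (c x)].

Definition cs_graph c s : graph H := [set p | exists2 x, p.1 = c x & p.2 = s x].

Lemma cs_nm c s x : cs_pair c s -> nm x ^+ 2 = nm (c x) ^+ 2 + nm (s x) ^+ 2.
Proof.
case=> [[cs ss] _ E _ _]; rewrite -[X in X = _]rip_nm -{1}(E x) ripDl.
by rewrite (adj_rip _ _ cs) (adj_rip _ _ ss) !rip_nm.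
Qed.

Lemma cs_c_le c s x : cs_pair c s -> nm (c x) <= nm x.
Proof.
move=> h; apply: nm_le_sq; rewrite (cs_nm x h).
by have := sqr_ge0 (nm (s x)); lra.
Qed.

Lemma cs_s_le c s x : cs_pair c s -> nm (s x) <= nm x.
Proof.
move=> h; apply: nm_le_sq; rewrite (cs_nm x h).
by have := sqr_ge0 (nm (c x)); lra.
Qed.

Lemma cs_range_dense c s : cs_pair c s ->
  forall x (e : R), 0 < e -> exists y, nm (c y - x) < e.
Proof.
case=> [[cs ss] _ _ c0 _].
have : dense (range c).
  apply: orth_dense.
    apply/subspaceP; split; first by exists 0 => //; exact: adj0 cs.
    move=> a _ _ [x _ <-] [y _ <-]; exists (a *: x + y) => //.
    by rewrite (adjD _ _ cs) (adjZ _ _ cs).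
  move=> x hx; apply: c0; apply: ip_self0; rewrite cs; apply: hx.
  by exists (c x).
move=> /denseP h x e /(h x)[_ [y _ <-] ?].
by exists y.
Qed.

Lemma cs_selfadjoint c s : cs_pair c s -> selfadjoint (cs_graph c s).
Proof.
move=> csp; case: (csp) => [[cs ss] cc E c0 sp]; split.
- split.
    apply/subspaceP; split.
      by exists 0; [rewrite (adj0 cs)|rewrite (adj0 ss)].
    move=> a p q [x p1 p2] [y q1 q2]; exists (a *: x + y) => /=.
      by rewrite p1 q1 (adjD _ _ cs) (adjZ _ _ cs).
    by rewrite p2 q2 (adjD _ _ ss) (adjZ _ _ ss).
  move=> u v w [x /= ux vx] [y /= uy wy]; rewrite vx wy.
  suff -> : x = y by [].
  apply/eqP; rewrite -subr_eq0; apply/eqP/c0.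
  by rewrite (adjB _ _ cs) -ux -uy subrr.
- apply/denseP => x e /(cs_range_dense csp x)[y hy].
  by exists (c y) => //; exists (s y), y.
- apply/seteqP; split=> [[u v] h|[_ _] [x /= -> ->] _ _ [y /= -> ->]] /=.
    have sc : s u = c v.
      apply: ip_ext => x; rewrite ss cs.
      have /= := h (c x) (s x) (ex_intro2 _ _ x erefl erefl).
      by move=> /(congr1 Num.conj); rewrite -!ipC.
    (* If (u, v) = (c x, s x), then c u + s v = (c^2 + s^2) x = x. *)
    exists (c u + s v) => /=.
      by rewrite (adjD _ _ cs) -cc -sc E.
    by rewrite (adjD _ _ ss) cc sc E.
  by rewrite ss cc -cs.
Qed.

Lemma cs_positive c s : cs_pair c s -> positive_op (cs_graph c s).
Proof.
move=> [[cs ss] cc E c0 sp] _ _ [x /= -> ->].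
have f : sym (fun x => c (s x)) by move=> y z; rewrite cs ss cc.
have := sym_real x f; rewrite cs => ->.
by rewrite (adj_rip _ _ cs) lecR; apply: sp.
Qed.

Lemma cs_square c s u w : cs_pair c s ->
  op_comp (cs_graph c s) (cs_graph c s) (u, w) <->
  exists2 h, u = c (c h) & w = s (s h).
Proof.
move=> [[cs ss] cc E c0 sp]; split.
  move=> [v [[x /= -> ->] [y /= xy ->]]].
  have xE : x = c (c x + s y) by rewrite (adjD _ _ cs) -cc -xy E.
  exists (c x + s y); first by rewrite -xE.
  apply/eqP; rewrite -subr_eq0; apply/eqP/c0.
  by rewrite (adjB _ _ cs) -!cc -xE xy subrr.
move=> [h -> ->]; exists (s (c h)); split; first by exists (c h).
by exists (s h) => //=; exact: cc.
Qed.

(** If A = S^2, then c^2 = Q and s^2 = 1 - Q, so c and s are bounded square roots. *)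
Lemma cs_of_resolvent A Q : resolvent_of A Q ->
  exists c s, [/\ cs_pair c s, forall h, c (c h) = Q h &
    op_comp (cs_graph c s) (cs_graph c s) = A].
Proof.
move=> [Qs Qc Qc' Q0 AQ].
have [c [cs c1 cE ccomm]] := bounded_sqrt Qs Qc'.
have [||s [ss s1 sE scomm]] := @bounded_sqrt _ _ (fun x => x - Q x).
- by move=> x y; rewrite ipBl ipBr Qs.
- by move=> x; rewrite opprB addrC subrK.
have cc x : s (c x) = c (s x).
  apply: (ccomm s s) => // y; apply/esym/(scomm Q Q) => // z.
  by rewrite (adjB _ _ Qs).
(* A root d of c turns <s x, c x> into <s (d x), d x>, which is nonnegative. *)
have [d [ds d1 dE dcomm]] := bounded_sqrt cs c1.
have csp : cs_pair c s.
  split=> //.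
  - by move=> x; rewrite cE sE addrC subrK.
  - by move=> x cx; apply: Q0; rewrite -cE cx (adj0 cs).
  - move=> x; rewrite -dE ripC (adj_rip _ _ ds) -(dcomm s s ss cc).
    rewrite ripC; have := near1_pos (d x) ss s1.
    by have := sqr_ge0 (nm (s (d x))); lra.
exists c, s; split=> //; apply/seteqP; split=> -[u w].
  by move/(cs_square _ _ csp) => [h -> ->]; apply/AQ; exists h; rewrite ?cE ?sE.
by move=> /AQ[h -> ->]; apply/(cs_square _ _ csp); exists h; rewrite ?cE ?sE.
Qed.

Lemma selfadjointE X x y u v : selfadjoint X -> X (x, y) -> X (u, v) ->
  <|y, u|> = <|x, v|>.
Proof. by move=> [_ _ XX] Xxy; rewrite -{1}XX => /(adjointP Xxy). Qed.

Lemma selfadjoint_closed X : selfadjoint X -> closed_op X.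
Proof. by case=> _ _ <-; exact: adjoint_closed. Qed.

Lemma positive_opP X x y : positive_op X -> X (x, y) -> 0 <= rip y x.
Proof. by move=> Xp /Xp; rewrite lecE => /andP[_]. Qed.

(** Reduction to bounded roots: C = X Q and s c are both positive symmetric contractions with square
    Q (1 - Q), hence equal. So X agrees with the graph of (c, s) on the range of Q. *)
Lemma root_unique A Q c s X : resolvent_of A Q -> cs_pair c s ->
  (forall h, c (c h) = Q h) -> selfadjoint X -> positive_op X ->
  op_comp X X = A -> X = cs_graph c s.
Proof.
move=> [Qs Qc Qc' Q0 AQ] csp cE Xsa Xp XA.
have [[cs ss] cc E c0 sp] := csp.
have [Xo Xd XX] := Xsa.
have /choice[C hC] h : exists v, X (Q h, v) /\ X (v, h - Q h).
  have : A (Q h, h - Q h) by apply/AQ; exists h.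
  by rewrite -XA => -[v ?]; exists v.
have hC1 h : X (Q h, C h) by case: (hC h).
have hC2 h : X (C h, h - Q h) by case: (hC h).
(* X commutes with the resolvent: 1 + X^2 sends C u = X Q u to X u = w. *)
have CQ u w : X (u, w) -> C u = Q w.
  move=> Xuw; have : A (C u, w - C u).
    by rewrite -XA; exists (u - Q u); split; [exact: hC2|exact: op_sub (hC1 u)].
  move=> /AQ[h e1 e2]; rewrite e1; congr Q.
  by move: e2; rewrite e1 => /addIr.
have QsE h : Q h = h - s (s h) by rewrite -cE; apply/esym/(canLR (addrK _)); rewrite E.
have CE h : C h = s (c h).
  apply: (@bounded_root_unique C (fun x => s (c x))) => {h}.
  - move=> h g; rewrite -[g in LHS](subrK (Q g)) addrC ipDr.
    rewrite (selfadjointE Xsa (hC1 h) (hC1 g)) -(selfadjointE Xsa (hC2 h) (hC2 g)).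
    by rewrite -ipDl addrC subrK.
  - by move=> x y; rewrite ss cs cc.
  - move=> h; apply: nm_le_sq; rewrite -[h in leRHS](subrK (Q h)) addrC.
    rewrite (nm_sqD (Q h)) -(_ : rip (C h) (C h) = rip (Q h) (h - Q h)); last first.
      by rewrite /rip (selfadjointE Xsa (hC1 h) (hC2 h)).
    rewrite rip_nm.
    by have := sqr_ge0 (nm (C h)); have := sqr_ge0 (nm (Q h));
      have := sqr_ge0 (nm (h - Q h)); lra.
  - by move=> x; apply: le_trans (cs_s_le _ csp) (cs_c_le _ csp).
  - move=> h; rewrite -[h in X in rip _ X](subrK (Q h)) addrC ripDr.
    apply: addr_ge0; first exact: positive_opP Xp (hC1 h).
    by rewrite ripC; apply: positive_opP Xp (hC2 h).
  - by move=> x; rewrite cc (adj_rip _ _ cs); apply: sp.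
  - move=> h; rewrite (CQ _ _ (hC2 h)).
    rewrite -(cc (c h)) cE (adjB _ _ Qs).
    by apply/(canLR (addrK _)); rewrite addrC -(cE (Q h)) E.
(* Since the range of c is dense and X is closed, the agreement on c (c y) extends to all c x.
   Equality follows because a self-adjoint operator has no proper self-adjoint extension. *)
have sub : cs_graph c s `<=` X.
  move=> [_ _] [x /= -> ->]; have /closedP := selfadjoint_closed Xsa; apply.
  move=> e e0; have [y hy] := cs_range_dense csp x e0.
  exists (c (c y), s (c y)); first by rewrite -CE cE.
  rewrite -(adjB _ _ cs) -(adjB _ _ ss) /=.
  split; apply: (le_lt_trans _ hy); [exact: cs_c_le csp|exact: cs_s_le csp].
apply/seteqP; split=> // -[u v]; rewrite -XX => h.
have [_ _ <-] := cs_selfadjoint csp.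
by move=> x y /sub/h.
Qed.

Lemma selfadjoint_resolvent X : selfadjoint X -> positive_op X ->
  (forall h, exists u v, X (u, v) /\ h = u + v) ->
  exists Q, resolvent_of X Q.
Proof.
move=> Xsa Xp surj; have [Xo Xd XX] := Xsa.
have /choice[Q hQ] h : exists u, X (u, h - u).
  by have [u [v [Xuv ->]]] := surj h; exists u; rewrite addrC addKr.
have dec h : nm h ^+ 2 = nm (Q h) ^+ 2 + 2 * rip (h - Q h) (Q h) + nm (h - Q h) ^+ 2.
  by rewrite ripC -nm_sqD addrC subrK.
have pos h : 0 <= rip (h - Q h) (Q h) by apply: positive_opP Xp (hQ h).
exists Q; split.
- move=> h g; rewrite -[g in LHS](subrK (Q g)) addrC ipDr.
  by rewrite -(selfadjointE Xsa (hQ h) (hQ g)) -ipDl addrC subrK.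
- move=> h; apply: nm_le_sq; rewrite (dec h).
  by have := pos h; have := sqr_ge0 (nm (h - Q h)); lra.
- move=> h; apply: nm_le_sq; rewrite (dec h).
  by have := pos h; have := sqr_ge0 (nm (Q h)); lra.
- move=> h e; have := hQ h; rewrite e subr0 => hh.
  exact: (proj2 Xo) hh (op_zero Xo).
- move=> u w; split=> [Xuw|[h -> ->]] //.
  pose h := u + w.
  have := op_sub Xo Xuw (hQ h).
  have -> : w - (h - Q h) = - (u - Q h).
    by rewrite /h opprB (addrC u) opprD !addrA (addrC w) addrK opprB.
  move=> /(positive_opP Xp); rewrite ripNl rip_nm => e.
  have /eqP : u - Q h = 0 by apply: nm_sq0; lra.
  by rewrite subr_eq0 => /eqP ue; exists h => //; rewrite -ue /h addrC addKr.
Qed.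

(* [(1 + S)^-1] exists because [(c + s)^2 = 1 + 2 c s] is onto, being
   [1 + t^2] for the bounded operator [t = sqrt (2 c s)]. *)
Lemma cs_resolvent c s : cs_pair c s -> exists Q, resolvent_of (cs_graph c s) Q.
Proof.
move=> csp; have [[cs ss] cc E c0 sp] := csp.
apply: selfadjoint_resolvent (cs_selfadjoint csp) (cs_positive csp) _ => h.
have [||t [ts _ tE _]] := @bounded_sqrt _ _ (fun x => 2 *: c (s x)).
- by move=> x y; rewrite ipZl ipZr cs ss cc rmorph_nat.
- move=> x.
  (* 1 - 2 c s = (c - s)^2, and c - s is a contraction because <s z, c z> >= 0. *)
  have -> : x - 2 *: c (s x) = (c (c x - s x) - s (c x - s x)).
    rewrite (adjB _ _ cs) (adjB _ _ ss) cc -{1}(E x); vec.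
  have D z : nm (c z - s z) <= nm z.
    apply: nm_le_sq; rewrite nm_sqB (cs_nm z csp) ripC.
    by have := sp z; lra.
  exact: le_trans (D _) (D _).
have to : is_operator (graph_of t).
  split; last by move=> x y z; rewrite /graph_of /= => -> ->.
  apply/subspaceP; split; first by rewrite /graph_of /= (adj0 ts).
  by move=> a p q; rewrite /graph_of /= => -> ->; rewrite (adjD _ _ ts) (adjZ _ _ ts).
have tadj : adjoint (graph_of t) = graph_of t.
  apply/seteqP; split=> [[u v] hu|[u v]]; rewrite /graph_of /=; last first.
    by move=> -> x y /= ->; rewrite ts.
  by apply: ip_ext => z; rewrite ts ipC -(hu z (t z) erefl) -ipC.
have [Q _ hQ] := von_neumann to (ltac:(by rewrite /closed_op -tadj; apply: adjoint_closed))
  (ltac:(by apply/denseP => x e e0; exists x; [exists (t x)|rewrite subrr nm0])).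
have [v] := hQ h; rewrite tadj /graph_of /= => ->; rewrite tE => e.
pose u := Q h; exists (c (c u + s u)), (s (c u + s u)); split; first by exists (c u + s u).
rewrite -[LHS](subrK (Q h)) e -/u (adjD _ _ cs) (adjD _ _ ss) cc -{2}(E u).
vec.
Qed.

Lemma op_sqrt_resolvent A Q : resolvent_of A Q -> exists c s,
  [/\ cs_pair c s, forall h, c (c h) = Q h, op_sqrt A = cs_graph c s &
    op_comp (cs_graph c s) (cs_graph c s) = A].
Proof.
move=> AQ; have [c [s [csp cE SS]]] := cs_of_resolvent AQ.
exists c, s; split=> //; rewrite /op_sqrt.
case: xgetP => [S -> [Ssa Sp SA]|/(_ (cs_graph c s))].
  exact: root_unique AQ csp cE Ssa Sp SA.
by case; split=> //; [exact: cs_selfadjoint|exact: cs_positive].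
Qed.

Lemma op_sqrt_square X : selfadjoint X -> positive_op X ->
  op_sqrt (op_comp X X) = X /\ exists c s, cs_pair c s /\ X = cs_graph c s.
Proof.
move=> Xsa Xp; have [Xo Xd XX] := Xsa.
have [Q] := von_neumann Xo (selfadjoint_closed Xsa) Xd.
rewrite XX => XQ _; have [c [s [csp cE -> _]]] := op_sqrt_resolvent XQ.
by have := root_unique XQ csp cE Xsa Xp erefl => ->; split=> //; exists c, s.
Qed.

End UnboundedSqrt.

(** * Polar decomposition *)

Section Polar.
Variables (R : realType) (H : hilbert R).
Implicit Types (x y z : H) (S T A X : graph H) (f g c s Q U V : H -> H).

Lemma near_pt_inner (K0 : set (H * H)) :
  (forall k l, K0 k -> K0 l -> <|k.1, l.1|> = <|k.2, l.2|>) ->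
  forall k l, near_pt K0 k -> near_pt K0 l -> <|k.1, l.1|> = <|k.2, l.2|>.
Proof.
move=> h.
have step (l : H * H) : (forall k, K0 k -> <|k.1, l.1|> = <|k.2, l.2|>) ->
    forall k, near_pt K0 k -> <|k.1, l.1|> = <|k.2, l.2|>.
  move=> hl k hk; apply/eqP; rewrite -subr_eq0; apply/eqP.
  apply: (@cn_eps _ _ (nm l.1 + nm l.2)) => e /hk[k' Kk' [k1 k2]].
  have -> : <|k.1, l.1|> - <|k.2, l.2|> =
      <|k'.2 - k.2, l.2|> - <|k'.1 - k.1, l.1|>.
    by rewrite !ipBl (hl _ Kk'); ring.
  apply: (le_trans (cnD _ _)); rewrite cnN mulrDr addrC lerD//.
    apply: (le_trans (cauchy_schwarz _ _)).
    by rewrite ler_wpM2r ?nm_ge0// ltW.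
  apply: (le_trans (cauchy_schwarz _ _)).
  by rewrite ler_wpM2r ?nm_ge0// ltW.
move=> k l hk hl; apply: (step l _ k hk) => {hk}k Kk.
by rewrite ipC (step k _ l hl) -?ipC// => {hl}l Kl; apply: h.
Qed.

Lemma dbl0 (a : R[i]) : a + a = 0 -> a = 0.
Proof. by move=> /eqP; rewrite -mulr2n mulrn_eq0 => /eqP. Qed.

(** The closure K of the pairs (f x, g x) is the graph of an isometry between closed subspaces. U is
    this isometry after the projection onto the first subspace, V its inverse after the projection
    onto the second. *)
Lemma partial_isometry f g :
  (forall a x y, f (a *: x + y) = a *: f x + f y) ->
  (forall a x y, g (a *: x + y) = a *: g x + g y) ->
  (forall x y, <|f x, f y|> = <|g x, g y|>) ->
  exists U V, [/\ adj U V,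
    (forall x, nm (U x) <= nm x) /\ (forall x, nm (V x) <= nm x),
    (forall x, U (f x) = g x) /\ (forall x, V (g x) = f x),
    forall x, U (V (U x)) = U x & forall x, V (U (V x)) = V x].
Proof.
move=> fl gl fg.
pose K0 : set (H * H) := [set p | exists x, p = (f x, g x)].
have K0s : lin_subspace K0.
  have f0 : f 0 = 0.
    by have := fl (-1) 0 0; rewrite scaleN1r oppr0 addr0 scaleN1r addNr.
  have g0 : g 0 = 0.
    by have := gl (-1) 0 0; rewrite scaleN1r oppr0 addr0 scaleN1r addNr.
  apply/subspaceP; split; first by exists 0; rewrite f0 g0.
  by move=> a _ _ [x ->] [y ->]; exists (a *: x + y); rewrite fl gl.
pose K := near_pt K0.
have Ks : lin_subspace K := near_pt_subspace K0s.
have Kc : closed K := @near_pt_closed _ _ _.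
have Ki k l : K k -> K l -> <|k.1, l.1|> = <|k.2, l.2|>.
  by apply: near_pt_inner => {k l} _ _ [x ->] [y ->]; apply: fg.
have KK x : K (f x, g x) by apply: near_pt_sub; exists x.
have /choice[u hu] h : exists k, K k /\ forall l, K l -> <|h - k.1, l.1|> = 0.
  (* Both components of k contribute the same inner product with l, so orthogonality reads <2 h - 2
     k.1, l.1> = 0. Doubling h makes k.1 the projection of h itself. *)
  have [k Kk hk] := projection (h + h, 0) Ks Kc; exists k; split=> // l Kl.
  have := hk _ Kl; rewrite /= sub0r ipNl -(Ki _ _ Kk Kl) => e.
  by apply: dbl0; rewrite -[RHS]e !ipBl ipDl; ring.
have /choice[v hv] h : exists k, K k /\ forall l, K l -> <|h - k.2, l.2|> = 0.
  have [k Kk hk] := projection (0, h + h) Ks Kc; exists k; split=> // l Kl.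
  have := hk _ Kl; rewrite /= sub0r ipNl (Ki _ _ Kk Kl) => e.
  by apply: dbl0; rewrite -[RHS]e !ipBl ipDl; ring.
have Uk m : K m -> (u m.1).2 = m.2.
  move=> Km; have [K1 h1] := hu m.1.
  have Kd := subspaceB Ks Km K1.
  have := h1 _ Kd; have := Ki _ _ Kd Kd => /= -> /ip_self0/eqP.
  by rewrite subr_eq0 => /eqP.
have Vk m : K m -> (v m.2).1 = m.1.
  move=> Km; have [K1 h1] := hv m.2.
  have Kd := subspaceB Ks Km K1.
  have := h1 _ Kd; have := Ki _ _ Kd Kd => /= <- /ip_self0/eqP.
  by rewrite subr_eq0 => /eqP.
exists (fun h => (u h).2), (fun h => (v h).1); split.
- move=> h y; have [K1 h1] := hu h; have [K2 h2] := hv y.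
  have e1 : <|(u h).2, y|> = <|(u h).2, (v y).2|>.
    have := h2 _ K1; rewrite ipBl => /eqP; rewrite subr_eq0 => /eqP e.
    by rewrite ipC e -ipC.
  have := h1 _ K2; rewrite ipBl => /eqP; rewrite subr_eq0 => /eqP ->.
  by rewrite e1 (Ki _ _ K1 K2).
- split=> h; apply: nm_le_sq.
    have [K1 h1] := hu h.
    have -> : nm (u h).2 ^+ 2 = nm (u h).1 ^+ 2 by rewrite -!rip_nm /rip Ki.
    rewrite -{2}(subrK (u h).1 h) nm_sqD /rip h1//=.
    by have := sqr_ge0 (nm (h - (u h).1)); lra.
  have [K1 h1] := hv h.
  have -> : nm (v h).1 ^+ 2 = nm (v h).2 ^+ 2 by rewrite -!rip_nm /rip Ki.
  rewrite -{2}(subrK (v h).2 h) nm_sqD /rip h1//=.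
  by have := sqr_ge0 (nm (h - (v h).2)); lra.
- by split=> x; [apply: (Uk (_, _))|apply: (Vk (_, _))].
- by move=> h; have [K1 _] := hu h; rewrite (Vk _ K1) (Uk _ K1).
- by move=> h; have [K1 _] := hv h; rewrite (Uk _ K1) (Vk _ K1).
Qed.

(* [T = U S] with [S = |T|]; [V] is the adjoint of the partial isometry [U]. *)
Lemma polar T : is_operator T -> closed_op T -> dense (dom T) ->
  exists c s U V,
  [/\ cs_pair c s /\ op_abs T = cs_graph c s,
     [/\ adj U V, (forall x, nm (U x) <= nm x), (forall x, U (V (U x)) = U x) &
       forall x, V (U (s x)) = s x],
     forall x y, T (x, y) <-> exists2 w, op_abs T (x, w) & y = U w &
     forall y a, adjoint T (y, a) <-> op_abs T (V y, a)].
Proof.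
move=> To Tc Td; have [Q AQ /(_ _)/cid2 hQ] := von_neumann To Tc Td.
have [c [s [csp cE SE SS]]] := op_sqrt_resolvent AQ.
rewrite /op_abs SE.
have [Qs _ _ _ _] := AQ.
have [[cs ss] cc E c0 sp] := csp.
pose v h := s2val (hQ h).
have Tv h : T (Q h, v h) := s2valP (hQ h).
have Av h : adjoint T (v h, h - Q h) := s2valP' (hQ h).
(* These two maps are |T| Q and T Q. *)
have [|||U [V [UV [Uc Vc] [Uf Vg] UVU VUV]]] := @partial_isometry (fun h => s (c h)) v.
- by move=> a x y; rewrite (adjD _ _ cs) (adjZ _ _ cs) (adjD _ _ ss) (adjZ _ _ ss).
- move=> a x y; apply: (proj2 To) (Tv _) _.
  by rewrite (adjD _ _ Qs) (adjZ _ _ Qs); apply: op_lin.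
- move=> h g; rewrite (adjointP (Tv h) (Av g)).
  have -> : g - Q g = s (s g).
    by rewrite -(cE g); apply/(canLR (addrK _)); rewrite addrC E.
  by rewrite -cE cs ss !cc.
have Us x : forall y, U (x - y) = U x - U y by move=> y; exact: adjB UV.
have Vs x : forall y, V (x - y) = V x - V y by move=> y; exact: adjB (adj_sym UV).
have VUs x : V (U (s x)) = s x.
  apply/eqP; rewrite -subr_eq0; apply/eqP/nm_le0; apply: (@le_eps _ _ _ 2) => e e0.
  have [h hx] := cs_range_dense csp x e0.
  have -> : V (U (s x)) - s x = s (c h - x) - V (U (s (c h - x))).
    by rewrite !(adjB _ _ ss) Us Vs Uf Vg; vec.
  apply: (le_trans (nmB _ _)).
  have := cs_s_le (c h - x) csp; have := Vc (U (s (c h - x))).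
  have := Uc (s (c h - x)); lra.
have sub x : T (c x, U (s x)).
  move/closedP: Tc; apply=> e e0.
  have [h hx] := cs_range_dense csp x e0.
  exists (Q h, v h); first exact: Tv.
  rewrite /= -cE -Uf -Us -(adjB _ _ ss) -(adjB _ _ cs).
  split; apply: (le_lt_trans _ hx); first exact: cs_c_le csp.
  exact: le_trans (Uc _) (cs_s_le _ csp).
have TE a b : T (a, b) <-> exists2 w, cs_graph c s (a, w) & b = U w.
  split=> [Tab|[_ [x /= -> ->] ->]] //.
  (* The only candidate: (a, b) = (c x, U (s x)) would give c a + s (V b) = (c^2 + s^2) x. *)
  pose x := c a + s (V b).
  have Td' := op_sub To Tab (sub x).
  (* Writing z = Q z + T* T Q z reduces |z|^2 to the inner product of c z + s V (b - U s x) with c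
     z, and the choice of x makes that first vector 0. *)
  have a0 : a - c x = 0.
    apply: ip_self0; set z := a - c x in Td' *.
    have -> : <|z, z|> = <|z, Q z|> + <|b - U (s x), v z|>.
      by rewrite (adjointP Td' (Av z)) -ipDr addrC subrK.
    have -> : v z = U (s (c z)) by rewrite Uf.
    rewrite -cE -(adj_sym UV) -ss -cs -ipDl Vs (adjB _ _ ss) VUs.
    rewrite /z (adjB _ _ cs).
    have -> : c a - c (c x) + (s (V b) - s (s x)) = 0.
      by rewrite addrACA -opprD E /x subrr.
    by rewrite ip0l.
  have b0 : b - U (s x) = 0.
    by move: Td'; rewrite a0 => h; exact: (proj2 To) h (op_zero To).
  move/eqP: a0; rewrite subr_eq0 => /eqP a0; move/eqP: b0; rewrite subr_eq0 => /eqP b0.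
  by exists (s x) => //; exists x.
exists c, s, U, V; split=> //.
have [_ _ Ssa] := cs_selfadjoint csp.
move=> y a; rewrite -Ssa; split=> [h _ _ [x /= -> ->]|h x b /TE[w Sxw ->]].
  by rewrite -UV; exact: h (sub x).
by rewrite UV; exact: h Sxw.
Qed.

(** The operator U X U*, with V in the role of U*. *)
Definition twist U V X : graph H := [set p | exists2 w, X (V p.1, w) & p.2 = U w].

Lemma twist_comp U V X : (forall x w, X (x, w) -> V (U w) = w) ->
  op_comp (twist U V X) (twist U V X) = twist U V (op_comp X X).
Proof.
move=> XV; apply/seteqP; split=> -[y z].
  move=> [_ [[w /= Xw ->] [w' /= Xw' ->]]]; exists w' => //.
  by exists w; split=> //; rewrite -(XV _ _ Xw).
move=> [w' [w [/= Xw Xw']] /= ->]; exists (U w); split; first by exists w.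
by exists w' => //=; rewrite (XV _ _ Xw).
Qed.

Lemma adj_partial U V : adj U V -> (forall x, U (V (U x)) = U x) ->
  forall x, V (U (V x)) = V x.
Proof.
move=> UV UVU x; apply: ip_ext => z.
by rewrite (adj_sym UV) UV (adj_sym UV) UVU -(adj_sym UV).
Qed.

(** x - V (U x) is orthogonal to the range of X, hence in the kernel of X* = X. *)
Lemma twist_dom U V X : selfadjoint X -> adj U V ->
  (forall x w, X (x, w) -> V (U w) = w) ->
  forall x w, X (x, w) -> X (V (U x), w).
Proof.
move=> [Xo _ XX] UV XV x w Xxw; have VU := adj_sym UV.
have Xk : X (x - V (U x), 0).
  rewrite -XX => u v Xuv /=.
  by rewrite ip0r ipBr -UV -VU (XV _ _ Xuv) subrr.
by have := op_sub Xo Xxw Xk; rewrite subr0 opprB addrC subrK.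
Qed.

Lemma twist_selfadjoint U V X : selfadjoint X -> adj U V ->
  (forall x, U (V (U x)) = U x) -> (forall x w, X (x, w) -> V (U w) = w) ->
  selfadjoint (twist U V X).
Proof.
move=> Xsa UV UVU XV; have [Xo Xd XX] := Xsa; have VU := adj_sym UV.
have Xs : lin_subspace (twist U V X).
  apply/subspaceP; split.
    by exists 0; rewrite /= ?(adj0 VU) ?(adj0 UV)//; exact: op_zero.
  move=> a p q [w Xw ew] [w' Xw' ew']; exists (a *: w + w') => /=.
    by rewrite (adjD _ _ VU) (adjZ _ _ VU); exact: op_lin.
  by rewrite ew ew' (adjD _ _ UV) (adjZ _ _ UV).
have XVU := twist_dom Xsa UV XV.
have VUV := adj_partial UV UVU.
split.
- split=> // x y z [w Xw /= ->] [w' Xw' /= ->].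
  by congr U; exact: (proj2 Xo) Xw Xw'.
- apply: orth_dense.
    apply/subspaceP; split; first by exists 0; case/subspaceP: Xs.
    move=> a x y [x' Tx] [y' Ty]; exists (a *: x' + y').
    by case/subspaceP: Xs => _ /(_ a _ _ Tx Ty).
  move=> y hy; have Vy0 : V y = 0.
    apply: dense_orth Xd _ => x [w Xw].
    rewrite VU; apply: hy; exists (U w), w => //=; exact: XVU.
  (* As V y = 0, the vector y itself lies in the domain to which it is orthogonal. *)
  apply: ip_self0; apply: hy; exists (U 0), 0 => //=.
  by rewrite Vy0; exact: op_zero.
- apply/seteqP; split=> [[a b] h|[a b] [w' /= Xw' ->] y z [w /= Xw ->]] /=; last first.
    by rewrite UV -VU; exact: selfadjointE Xsa Xw Xw'.
  (* This vector is killed by V, so the twist maps it to 0; testing the adjoint relation on it shows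
     that it is orthogonal to itself. *)
  have bU : b - U (V b) = 0.
    have Vd : V (b - U (V b)) = 0 by rewrite (adjB _ _ VU) VUV subrr.
    apply: ip_self0; rewrite ipBr -[X in _ - X](VU _ _) Vd ip0l subr0.
    rewrite -(h _ 0) ?ip0l//; exists 0; last by rewrite (adj0 UV).
    by rewrite /= Vd; exact: op_zero.
  exists (V b) => /=; last by apply/eqP; rewrite -subr_eq0 bU.
  rewrite -XX => x w Xw /=.
  rewrite -UV -[RHS]UV.
  by apply: h; exists w => //=; exact: XVU.
Qed.

Lemma twist_positive U V X : adj U V -> positive_op X -> positive_op (twist U V X).
Proof. by move=> UV Xp x y [w Xw /= ->]; rewrite UV; exact: Xp Xw. Qed.

(** With T = U X and T* = X V, the product T T* is U X^2 V. The remaining point, T** = T, is proved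
    as for the self-adjointness of the twist. *)
Lemma adjoint_polar T X U V : selfadjoint X -> adj U V ->
  (forall x, U (V (U x)) = U x) -> (forall x w, X (x, w) -> V (U w) = w) ->
  (forall x y, T (x, y) <-> exists2 w, X (x, w) & y = U w) ->
  (forall y a, adjoint T (y, a) <-> X (V y, a)) ->
  op_comp (adjoint (adjoint T)) (adjoint T) = twist U V (op_comp X X).
Proof.
move=> Xsa UV UVU XV TX AX; have [Xo Xd XX] := Xsa; have VU := adj_sym UV.
have XVU := twist_dom Xsa UV XV.
have VUV := adj_partial UV UVU.
have TT : adjoint (adjoint T) = T.
  apply/seteqP; split=> [[x z] h|[x z] Txz y a h] /=; last first.
    by rewrite ipC -(h _ _ Txz) -ipC.
  have zU : z - U (V z) = 0.
    have Vd : V (z - U (V z)) = 0 by rewrite (adjB _ _ VU) VUV subrr.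
    apply: ip_self0; rewrite ipBr -[X in _ - X](VU _ _) Vd ip0l subr0.
    rewrite -(h _ 0) ?ip0l//; apply/AX; rewrite Vd; exact: op_zero.
  apply/TX; exists (V z); last by apply/eqP; rewrite -subr_eq0 zU.
  rewrite -XX => u v Xuv /=; rewrite -UV.
  by apply: h; apply/AX; exact: XVU.
rewrite TT; apply/seteqP; split=> -[y z].
  move=> [a [/= /AX Xa /TX[w Xw ->]]]; exists w => //=.
  by exists a.
move=> [w [a [/= Xa Xw]] /= ->]; exists a; split; first exact/AX.
by apply/TX; exists w.
Qed.

End Polar.

(** * Countably subadditive seminorms *)

Section Zabreiko.
Variables (R : realType) (V : completeNormedModType R[i]).
Implicit Types (x y z : V).

Lemma half_pow_le (n : nat) : (2^-1) ^+ n <= n.+1%:R^-1 :> R.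
Proof.
rewrite exprVn lef_pV2 ?posrE ?exprn_gt0 ?ltr0n//.
by rewrite -natrX ler_nat; apply: ltn_expl.
Qed.

Lemma half_pow_sum (n : nat) : \sum_(k < n) (2^-1) ^+ k <= 2 :> R.
Proof.
suff -> : \sum_(k < n) (2^-1) ^+ k = 2 - 2 * (2^-1) ^+ n :> R.
  have : 0 <= (2^-1 : R) ^+ n by rewrite exprn_ge0// invr_ge0.
  lra.
elim: n => [|n IH]; first by rewrite big_ord0 expr0; ring.
by rewrite big_ord_recr/= IH exprS; field.
Qed.

Variable p : V -> R.

(** Baire's argument for the sets {p <= n}: if none were dense in a ball, nested balls with p > n on
    the n-th would shrink to a point where p has no finite value. *)
Lemma baire_ball : exists (n : nat) x0 (r : R), 0 < r /\
  forall y, nm (y - x0) < r -> forall e : R, 0 < e ->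
    exists2 z, nm (z - y) < e & p z <= n%:R.
Proof.
apply: contrapT => H.
have /choice[F FP] (q : nat * (V * R)) : exists q' : V * R, 0 < q.2.2 ->
    [/\ 0 < q'.2, nm (q'.1 - q.2.1) + q'.2 <= q.2.2, q'.2 <= q.1.+1%:R^-1 &
        forall z, nm (z - q'.1) <= q'.2 -> q.1%:R < p z].
  case: q => n [x r] /=.
  have [r0|nr0] := pselect (0 < r); last by exists (x, r) => /nr0.
  apply: contrapT => H1; apply: H; exists n, x, r; split=> // y yx e e0.
  apply: contrapT => H2; apply: H1.
  have n1 : (0 : R) < n.+1%:R^-1 by rewrite invr_gt0.
  pose r' := Num.min (Num.min (e / 2) (r - nm (y - x))) n.+1%:R^-1.
  have r'0 : 0 < r' by rewrite !lt_min n1 andbT; apply/andP; split; lra.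
  have [a1 a2 a3] : [/\ r' <= e / 2, r' <= r - nm (y - x) & r' <= n.+1%:R^-1].
    by rewrite /r' !ge_min !lexx ?orbT.
  exists (y, r') => _ /=; split=> //; first by lra.
  move=> z zy; rewrite ltNge; apply/negP => pz; apply: H2.
  by exists z => //; lra.
pose s := fix s n : V * R := if n is m.+1 then F (m, s m) else (0, 1).
have s0 n : 0 < (s n).2.
  elim: n => [|n IH]; first exact: ltr01.
  by have [h _ _ _] := FP (n, s n) IH; exact: h.
have sS n : [/\ nm ((s n.+1).1 - (s n).1) + (s n.+1).2 <= (s n).2,
    (s n.+1).2 <= n.+1%:R^-1 &
    forall z, nm (z - (s n.+1).1) <= (s n.+1).2 -> n%:R < p z].
  by have [_ h1 h2 h3] := FP (n, s n) (s0 n); split.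
have smn m n : (n <= m)%N -> nm ((s m).1 - (s n).1) + (s m).2 <= (s n).2.
  elim: m => [|m IH]; first by rewrite leqn0 => /eqP->; rewrite subrr nm0; lra.
  rewrite leq_eqVlt => /predU1P[->|/IH h]; first by rewrite subrr nm0; lra.
  have [h1 _ _] := sS m; have := nm_tri (s m.+1).1 (s m).1 (s n).1; lra.
have [x xP] : exists x, lim_seq (fun n => (s n).1) x.
  apply: cauchy_nm_lim => e e0; have [n0 h] := archi_inv (ltac:(lra) : 0 < e / 2).
  exists n0.+1 => i j hi hj.
  have hn := h _ (leqnn _); have [_ h2 _] := sS n0.
  have h3 := smn _ _ hi; have h4 := smn _ _ hj.
  have h5 := nm_tri (s i).1 (s n0.+1).1 (s j).1.
  rewrite (nmC (s n0.+1).1) in h5.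
  have := s0 i; have := s0 j; move: (n0.+1%:R^-1) hn h2 => a; lra.
have xn n : nm (x - (s n).1) <= (s n).2.
  apply: (@le_eps _ _ _ 1) => e /xP[n0 h].
  have h1 := h (maxn n n0) (leq_maxr _ _); have h2 := smn _ _ (leq_maxl n n0).
  have h3 := nm_tri x (s (maxn n n0)).1 (s n).1; rewrite nmC in h1.
  by have := s0 (maxn n n0); lra.
have : (Num.truncn (p x)).+1%:R < p x.
  by case: (sS (Num.truncn (p x)).+1) => _ _; apply.
by have := truncnS_gt (p x); lra.
Qed.

(** By homogeneity, a vector of norm below r / 2^k is within r / 2^(k+1) of some z with p z <= M /
    2^k. Iterating on the remainders writes a small y as a series, and countable subadditivity
    bounds p y by 2 M. *)
Lemma zabreiko :
  (forall x, 0 <= p x) -> (forall x y, p (x + y) <= p x + p y) ->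
  (forall (t : R) x, p (t%:C *: x) = `|t| * p x) ->
  (forall (u : nat -> V) x M, lim_seq (fun n => \sum_(k < n) u k) x ->
     (forall n, \sum_(k < n) p (u k) <= M) -> p x <= M) ->
  exists2 C : R, 0 <= C & forall x, p x <= C * nm x.
Proof.
move=> p0 pD pZ psum.
have pN x : p (- x) = p x.
  by rewrite -scaleN1r -(_ : (-1)%:C = -1) ?pZ ?normrN1 ?mul1r// rmorphN1.
have [n [x0 [r [r0 B]]]] := baire_ball.
(* Vectors near 0 are approximated by differences of two points near x0, each with p at most n. *)
pose M : R := 2 * n%:R.
have M0 : 0 <= M by rewrite mulr_ge0.
have B0 y : nm y < r -> forall e : R, 0 < e -> exists2 z, nm (z - y) < e & p z <= M.
  move=> yr e e0.
  have [|z1 z1y pz1] := B (x0 + y) _ (e / 2) ltac:(lra); first by rewrite addrAC subrr add0r.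
  have [|z2 z2x pz2] := B x0 _ (e / 2) ltac:(lra); first by rewrite subrr nm0.
  exists (z1 - z2).
    have -> : z1 - z2 - y = (z1 - (x0 + y)) - (z2 - x0).
      by rewrite opprB opprD !addrA [in RHS](addrAC _ (- y) x0) subrK addrAC.
    by apply: (le_lt_trans (nmB _ _)); lra.
  by apply: le_trans (pD _ _) _; rewrite pN /M; lra.
have Bk (k : nat) y : nm y < r * (2^-1) ^+ k ->
    exists z, nm (y - z) < r * (2^-1) ^+ k.+1 /\ p z <= M * (2^-1) ^+ k.
  set t : R := (2^-1) ^+ k => yr.
  have t0 : 0 < t by rewrite exprn_gt0// invr_gt0.
  have y'r : nm (t^-1%:C *: y) < r.
    by rewrite nmZr ger0_norm ?invr_ge0 ?(ltW t0)// mulrC ltr_pdivrMr.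
  have [z zy pz] := B0 _ y'r (r / 2) ltac:(lra).
  exists (t%:C *: z); split.
    have -> : y - t%:C *: z = - (t%:C *: (z - t^-1%:C *: y)).
      by rewrite scalerBr scalerA -rmorphM mulfV ?gt_eqF// scale1r opprB.
    rewrite nmN nmZr gtr0_norm// exprS -/t.
    have -> : r * (2^-1 * t) = t * (r / 2) by ring.
    by rewrite ltr_pM2l.
  by rewrite pZ gtr0_norm// mulrC ler_pM2r.
have /choice[F FP] (q : nat * V) : exists z, nm q.2 < r * (2^-1) ^+ q.1 ->
    nm (q.2 - z) < r * (2^-1) ^+ q.1.+1 /\ p z <= M * (2^-1) ^+ q.1.
  have [h|h] := pselect (nm q.2 < r * (2^-1) ^+ q.1); last by exists 0 => /h.
  by have [z zP] := Bk _ _ h; exists z.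
have small y : nm y < r -> p y <= 2 * M.
  move=> yr.
  pose s := fix s k : V := if k is m.+1 then s m - F (m, s m) else y.
  have sr k : nm (s k) < r * (2^-1) ^+ k.
    by elim: k => [|k IH] /=; [rewrite mulr1|case: (FP (k, s k) IH)].
  have su k : \sum_(i < k) F (i : nat, s i) = y - s k.
    elim: k => [|k IH]; first by rewrite big_ord0 subrr.
    by rewrite big_ord_recr/= IH opprB addrCA addrC.
  apply: (psum (fun i => F (i, s i))) => [e e0|k].
    have [n0 h] := archi_inv (divr_gt0 e0 r0); exists n0 => k /h h1.
    rewrite su addrAC subrr add0r nmN; apply: (lt_trans (sr k)).
    by rewrite mulrC -ltr_pdivlMr//; apply: le_lt_trans (half_pow_le _) _.
  apply: (@le_trans _ _ (\sum_(i < k) M * (2^-1) ^+ i)).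
    by apply: ler_sum => i _; case: (FP (i : nat, s i) (sr i)).
  by rewrite -mulr_sumr mulrC ler_wpM2r// half_pow_sum.
(* x is rescaled to norm r / 2, where p is at most 2 M. *)
exists (4 * M / r); first by rewrite divr_ge0 ?mulr_ge0// ltW.
move=> x; have [x00|x00] := eqVneq x 0.
  have := pZ 0 0; rewrite scaler0 normr0 mul0r x00 => ->.
  by rewrite nm0 mulr0.
have nx : 0 < nm x.
  rewrite lt_neqAle nm_ge0 andbT eq_sym; apply: contraNneq x00 => h.
  by apply/eqP/nm_le0; rewrite h.
pose t := r / (2 * nm x).
have t0 : 0 < t by rewrite divr_gt0// mulr_gt0.
have : p (t%:C *: x) <= 2 * M.
  apply: small; rewrite nmZr gtr0_norm//.
  have -> : t * nm x = r / 2 by rewrite /t; field; rewrite gt_eqF.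
  by lra.
rewrite pZ gtr0_norm// mulrC -ler_pdivlMr// => /le_trans; apply.
rewrite le_eqVlt; apply/orP; left; apply/eqP.
by rewrite /t; field; rewrite !gt_eqF.
Qed.

End Zabreiko.

(** * The domain of the square root of |T| *)

Section FormDomain.
Variables (R : realType) (H : hilbert R).
Implicit Types (x y z : H) (S T A X : graph H) (f g c s Q U V : H -> H).

(** Twisting commutes with squaring, so |T*| is the twist of S = |T|, and its root is the twist of
    the root F of S. *)
Lemma op_abs_dual_sqrt T : is_operator T -> closed_op T -> dense (dom T) ->
  exists c s c' s' U V,
  [/\ cs_pair c s /\ op_sqrt (op_abs T) = cs_graph c s,
      cs_pair c' s' /\ op_sqrt (op_abs (adjoint T)) = cs_graph c' s',
      [/\ adj U V, forall x, nm (U x) <= nm x & forall x, V (U (s x)) = s x],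
      cs_graph c' s' = twist U V (cs_graph c s) &
      forall x y, T (x, y) <->
        exists2 w, op_comp (cs_graph c s) (cs_graph c s) (x, w) & y = U w].
Proof.
move=> To Tc Td.
have [c1 [s1 [U [V [[csp1 SE] [UV Uc UVU VUs] TE AE]]]]] := polar To Tc Td.
rewrite SE in TE AE *.
set S := cs_graph c1 s1 in SE TE AE *.
have Ssa : selfadjoint S := cs_selfadjoint csp1.
have Sp : positive_op S := cs_positive csp1.
have [Q1 SQ] := cs_resolvent csp1.
have [c [s [csp _ FE FF]]] := op_sqrt_resolvent SQ.
rewrite -/S in SQ FE FF; set F := cs_graph c s in FE FF *.
have Fsa : selfadjoint F := cs_selfadjoint csp.
have Fp : positive_op F := cs_positive csp.
have VU := adj_sym UV.
have SV x w : S (x, w) -> V (U w) = w by move=> [u _ /= ->]; exact: VUs.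
(* g - V (U g) is in the kernel of S = F F, hence in that of F, hence orthogonal to the range of
   F. *)
have FV x w : F (x, w) -> V (U w) = w.
  move=> Fxw; apply/eqP; rewrite eq_sym -subr_eq0; apply/eqP.
  apply: ip_ext => g; rewrite ip0l ipBl VU UV -ipBr; set z := g - _.
  have Sz : S (z, 0).
    have [_ _ <-] := Ssa; move=> u v Suv /=.
    by rewrite ip0r /z ipBr -UV -VU (SV _ _ Suv) subrr.
  move: Sz; rewrite -FF => -[m [/= Fzm Fm0]].
  have m0 : m = 0.
    by apply: ip_self0; rewrite (selfadjointE Fsa Fzm Fm0) ip0r.
  by rewrite m0 in Fzm; rewrite (selfadjointE Fsa Fxw Fzm) ip0r.
have [Sabs _] := op_sqrt_square (twist_selfadjoint Ssa UV UVU SV) (twist_positive UV Sp).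
have [Fabs [c' [s' [csp' FE']]]] :=
  op_sqrt_square (twist_selfadjoint Fsa UV UVU FV) (twist_positive UV Fp).
have TS : op_abs (adjoint T) = twist U V S.
  by rewrite /op_abs (adjoint_polar Ssa UV UVU SV TE AE) -(twist_comp SV).
exists c, s, c', s', U, V; rewrite -FE'; split=> //.
- by rewrite TS -[in LHS]FF -(twist_comp FV).
- by split=> // x; apply: (FV (c x)); exists x.
- by move=> x y; rewrite FF.
Qed.

Lemma pos_ReE (z : R[i]) : 0 <= z -> z = (complex.Re z)%:C /\ 0 <= complex.Re z.
Proof. by case: z => a b; rewrite lecE /= => /andP[/eqP-> ?]. Qed.

Lemma sum_cauchy (P : nat -> R) (M : R) : (forall n, P n <= P n.+1) ->
  (forall n, P n <= M) -> forall e, 0 < e ->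
  exists n0, forall m n, (n0 <= n)%N -> (n <= m)%N -> P m - P n < e.
Proof.
move=> Pi PM e e0.
have Pmn m n : (n <= m)%N -> P n <= P m.
  elim: m => [|m IH]; first by rewrite leqn0 => /eqP->.
  by rewrite leq_eqVlt => /predU1P[->//|/IH/le_trans]; apply.
have hs : has_sup (range P).
  by split; [exists (P 0), 0%N|exists M => _ [n _ <-]].
have [_ [n0 _ <-] h] := sup_adherent e0 hs.
exists n0 => m n h1 h2.
have : P m <= sup (range P) by apply: ub_le_sup; [case: hs|exists m].
by have := Pmn _ _ h1; lra.
Qed.

(* Closed graph theorem for the identity of [D(S)], where [x |-> c x] is an
   isometry from [H] onto [D(S)] with its graph norm. *)
Lemma complete_norm_le c s (N : H -> R[i]) (alpha : R[i]) (D := range c) :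
  cs_pair c s -> is_norm_on D N -> complete_on D N -> 0 < alpha ->
  (forall x, D x -> `|x| <= alpha * N x) ->
  exists2 C : R, 0 <= C & forall x, N (c x) <= (C * nm x)%:C.
Proof.
move=> csp [N0 Nx0 NZ ND] Nc /pos_Re[a0 aE] Na.
have [[cs _] _ _ _ _] := csp.
pose q y := complex.Re (N y).
have qE x : N (c x) = (q (c x))%:C /\ 0 <= q (c x).
  by apply: pos_ReE; apply: N0; exists x.
have qD x y : q (c (x + y)) <= q (c x) + q (c y).
  have := ND _ _ (ex_intro2 _ _ x I erefl) (ex_intro2 _ _ y I erefl).
  rewrite -(adjD _ _ cs).
  by rewrite !(proj1 (qE _)) -rmorphD lecR.
have qZ (t : R) x : q (c (t%:C *: x)) = `|t| * q (c x).
  have := NZ t%:C _ (ex_intro2 _ _ x I erefl); rewrite -(adjZ _ _ cs).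
  by rewrite !(proj1 (qE _)) cnE cn_real -rmorphM => -[].
have qB x y : q (c (x - y)) = q (c (y - x)).
  have := qZ (-1) (y - x); rewrite normrN1 mul1r => <-; congr (q (c _)).
  by rewrite rmorphN1 scaleN1r opprB.
have qa x : nm (c x) <= complex.Re alpha * q (c x).
  have := Na (c x) (ex_intro2 _ _ x I erefl).
  by rewrite nmE aE (proj1 (qE x)) -rmorphM lecR.
have [x y|t x|u x M ux uM|C C0 CP] := @zabreiko R H (fun x => q (c x)) (fun x => proj2 (qE x)).
- exact: qD.
- exact: qZ.
(* Countable subadditivity: bounded sums of [q] make the partial sums Cauchy for [N], whose
   completeness provides a limit c x'. *)
- pose w n := \sum_(k < n) u k; pose P n := \sum_(k < n) q (c (u k)).
  have qw m n : (n <= m)%N -> q (c (w m - w n)) <= P m - P n.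
    elim: m => [|m IH].
      rewrite leqn0 => /eqP->; rewrite !subrr.
      by have := qZ 0 0; rewrite scaler0 normr0 mul0r => ->.
    rewrite leq_eqVlt => /predU1P[->|/IH h].
      by rewrite !subrr; have := qZ 0 0; rewrite scaler0 normr0 mul0r => ->.
    have -> : w m.+1 - w n = (w m - w n) + u m.
      by rewrite /w big_ord_recr/= addrAC.
    apply: le_trans (qD _ _) _.
    by rewrite {1}/P big_ord_recr/= -/(P m); lra.
  have Pc := @sum_cauchy P M (fun n => ltac:(by rewrite /P big_ord_recr/= lerDl; case: (qE (u n))))
    uM.
  have [|e /pos_Re[e0 eE]|z [x' _ <-] zP] := Nc (fun n => c (w n)).
  + by move=> n; exists (w n).
  + have [n0 h] := Pc _ e0; exists n0 => m n hm hn.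
    rewrite -(adjB _ _ cs) (proj1 (qE _)) eE ltcR.
    have [mn|/ltnW mn] := leqP n m.
      by apply: le_lt_trans (qw _ _ mn) _; apply: h.
    by rewrite qB; apply: le_lt_trans (qw _ _ mn) _; apply: h.
  have {}zP (e : R) : 0 < e -> exists n0, forall n, (n0 <= n)%N -> q (c (w n - x')) < e.
    move=> e0; have [|n0 h] := zP e%:C; first by rewrite ltcR.
    by exists n0 => n /h; rewrite -(adjB _ _ cs) (proj1 (qE _)) ltcR.
  (* Both convergences imply convergence in H, where limits are unique. *)
  have xE : c x = c x'.
    apply/eqP; rewrite -subr_eq0; apply/eqP/nm_le0.
    apply: (@le_eps _ _ _ (1 + complex.Re alpha)) => e e0.
    have [n1 h1] := ux _ e0; have [n2 h2] := zP _ e0.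
    have {}h1 := h1 _ (leq_maxl n1 n2); have {}h2 := h2 _ (leq_maxr n1 n2).
    have h3 := nm_tri (c x) (c (w (maxn n1 n2))) (c x').
    rewrite -!(adjB _ _ cs) in h3 *.
    have h4 := cs_c_le (x - w (maxn n1 n2)) csp; rewrite [in X in _ <= X]nmC in h4.
    have h5 := qa (w (maxn n1 n2) - x').
    have h6 := ler_wpM2l (ltW a0) (ltW h2).
    by move: h1; rewrite -/(w _) => h1; lra.
  rewrite xE; apply: (@le_eps _ _ _ 1) => e /zP[n0 /(_ n0 (leqnn _)) h].
  have := qD (x' - w n0) (w n0); rewrite subrK qB => h1.
  have := qw n0 0%N (leq0n _); rewrite /w /P !big_ord0 !subr0 => h2.
  have := uM n0; rewrite -/(P _) => h3.
  by rewrite -/(w n0) -/(P n0) in h2; lra.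
by exists C => // x; rewrite (proj1 (qE x)) lecR.
Qed.

Definition cinv c y : H := xget 0 [set x | c x = y].

Lemma cs_inj c s : cs_pair c s -> injective c.
Proof.
move=> [[cs _] _ _ c0 _] x y e; apply/eqP; rewrite -subr_eq0; apply/eqP/c0.
by rewrite (adjB _ _ cs) e subrr.
Qed.

Lemma cinvK c s x : cs_pair c s -> cinv c (c x) = x.
Proof.
move=> /cs_inj ci; rewrite /cinv; case: xgetP => [y _ /ci//|/(_ x)].
by case.
Qed.

(* The graph norm of [S] on [D(S)]. *)
Definition cs_norm c y : R[i] := `|cinv c y|.

Lemma cs_norm_is_norm c s : cs_pair c s -> is_norm_on (range c) (cs_norm c).
Proof.
move=> csp; have [[cs _] _ _ _ _] := csp; split.
- by move=> x _; exact: normr_ge0.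
- move=> _ [x _ <-]; rewrite /cs_norm (cinvK _ csp) => /eqP.
  by rewrite normr_eq0 => /eqP->; rewrite (adj0 cs).
- move=> a _ [x _ <-]; rewrite /cs_norm -(adjZ _ _ cs) !(cinvK _ csp).
  exact: normrZ.
- move=> _ _ [x _ <-] [y _ <-].
  by rewrite /cs_norm -(adjD _ _ cs) !(cinvK _ csp) ler_normD.
Qed.

Lemma cs_norm_complete c s : cs_pair c s -> complete_on (range c) (cs_norm c).
Proof.
move=> csp; have [[cs _] _ _ _ _] := csp.
move=> u /(_ _)/cid2 uD cu; pose v n := s2val (uD n).
have uE n : u n = c (v n) by rewrite -(s2valP' (uD n)).
have [|x xP] := @cauchy_nm_lim _ _ v.
  move=> e e0; have [|n0 h] := cu e%:C; first by rewrite ltcR.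
  exists n0 => m n hm hn; have := h m n hm hn.
  by rewrite !uE /cs_norm -(adjB _ _ cs) (cinvK _ csp) nmE ltcR.
exists (c x); first by exists x.
move=> e /pos_Re[/xP[n0 h] eE]; exists n0 => n /h.
by rewrite uE /cs_norm -(adjB _ _ cs) (cinvK _ csp) nmE eE ltcR.
Qed.

Lemma cs_antidual c s (L : H -> R[i]) : cs_pair c s ->
  antidual_on (range c) (cs_norm c) L -> exists g : H, forall x, L (c x) = <|g, x|>.
Proof.
move=> csp [Ll [k [k0 kL]]]; have [[cs _] _ _ _ _] := csp.
apply: (@riesz _ _ (fun x => L (c x)) (complex.Re k)) => [a x y|x].
  by rewrite (adjD _ _ cs) (adjZ _ _ cs) Ll//.
have := kL (c x) (ex_intro2 _ _ x I erefl).
have [kE _] := pos_ReE k0.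
by rewrite /cs_norm (cinvK _ csp) cnE nmE kE -rmorphM lecR.
Qed.

(** Riesz is used twice: on g |-> F (Lg g), which is antilinear and yields the point, and on a given
    L, which it identifies with some Lg g. *)
Lemma cs_norm_reflexive c s : cs_pair c s -> reflexive_on (range c) (cs_norm c).
Proof.
move=> csp F [Fl [M FM]]; have [[cs _] _ _ _ _] := csp.
pose Lg (g : H) (y : H) : R[i] := <|cinv c y, g|>.
have Lg_bound (g : H) : functional_bound (range c) (cs_norm c) (Lg g) (nm g)%:C.
  split; first by rewrite lecR nm_ge0.
  move=> _ [x _ <-]; rewrite /Lg /cs_norm (cinvK _ csp) cnE nmE -rmorphM lecR mulrC.
  exact: cauchy_schwarz.
have Lg_dual (g : H) : dual_on (range c) (cs_norm c) (Lg g).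
  split; last by exists (nm g)%:C; exact: Lg_bound.
  move=> a _ _ [x _ <-] [y _ <-]; rewrite /Lg -(adjZ _ _ cs) -(adjD _ _ cs).
  by rewrite !(cinvK _ csp) ipDl ipZl.
have [||x xP] := @riesz _ _ (fun g : H => F (Lg g)) (cn M).
- move=> a g h; rewrite -Fl//; congr F; apply/funext => y.
  by rewrite /Lg ipDr ipZr.
- move=> g; have := FM _ _ (Lg_dual g) (Lg_bound g).
  rewrite lecE => /andP[_ h]; apply: (le_trans h).
  by apply: le_trans (Re_le_cn _) _; rewrite cnM cn_real ger0_norm ?nm_ge0.
exists (c x); first by exists x.
move=> L Ld.
have [|g gP] := @cs_antidual c s (fun y => Num.conj (L y)) csp.
  case: Ld => Ll [k [k0 kL]]; split.
    by move=> a y z Dy Dz; rewrite Ll// rmorphD rmorphM.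
  by exists k; split=> // y Dy; rewrite norm_conjC; exact: kL.
have LE y : range c y -> L y = Lg g y.
  by move=> [z _ <-]; rewrite /Lg (cinvK _ csp) ipC -gP conjCK.
have FE : F L = F (Lg g).
  (* [L] and [Lg g] may differ off the domain; their difference has bound 0, so boundedness of [F]
     gives them the same value. *)
  have D0 : functional_bound (range c) (cs_norm c) (fun y => -1 * Lg g y + L y) 0.
    split=> // y Dy; rewrite mul0r (LE y Dy) mulN1r addNr normr0//.
  have Dd : dual_on (range c) (cs_norm c) (fun y => -1 * Lg g y + L y).
    split; last by exists 0.
    move=> a y z Dy Dz; rewrite (proj1 Ld)// (proj1 (Lg_dual g))//; ring.
  have := FM _ _ Dd D0; rewrite Fl// mulr0 normr_le0 mulN1r addrC subr_eq0.
  by move/eqP.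
by rewrite FE LE; [rewrite xP /Lg (cinvK _ csp)|exists x].
Qed.

End FormDomain.

Lemma dom_cs_graph (R : realType) (H : hilbert R) (c s : H -> H) :
  dom (cs_graph c s) = range c.
Proof.
apply/seteqP; split=> [x [y [u /= -> _]]|_ [u _ <-]]; first by exists u.
by exists (s u), u.
Qed.

Lemma lec_real (R : realType) (a b : R) (k : R[i]) :
  0 <= b -> (a%:C <= k * b%:C)%R -> a <= cn k * b.
Proof.
move=> b0; rewrite lecE => /andP[_ h]; apply: (le_trans h).
by apply: le_trans (Re_le_cn _) _; rewrite cnM cn_real ger0_norm.
Qed.

(** * The hyper-solvable form *)

Section HyperSolvable.
Variables (R : realType) (H : hilbert R) (T : graph H).
Variables (c s c' s' U V : H -> H).
Hypothesis csp : cs_pair c s.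
Hypothesis csp' : cs_pair c' s'.
Hypothesis UV : adj U V.
Hypothesis Uc : forall x, nm (U x) <= nm x.
Hypothesis VUs : forall x, V (U (s x)) = s x.
Hypothesis FE' : cs_graph c' s' = twist U V (cs_graph c s).
Hypothesis TE : forall x y, T (x, y) <->
  exists2 w, op_comp (cs_graph c s) (cs_graph c s) (x, w) & y = U w.
Hypothesis cc' : range c = range c'.

Let cs : sym c. Proof. by case: csp => -[]. Qed.
Let ss : sym s. Proof. by case: csp => -[]. Qed.
Let cs' : sym c'. Proof. by case: csp' => -[]. Qed.
Let ss' : sym s'. Proof. by case: csp' => -[]. Qed.

(** [s (cinv c x)] is |T|^(1/2) x, and [s' (cinv c' y)] is |T*|^(1/2) y. *)
Definition polar_form : sform H :=
  SForm (range c) (fun x y => <|U (s (cinv c x)), s' (cinv c' y)|>).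

Lemma polar_formE u v : polar_form (c u) (c' v) = <|U (s u), s' v|>.
Proof. by rewrite /= (cinvK _ csp) (cinvK _ csp'). Qed.

Lemma range_c' y : range c y -> exists v, y = c' v.
Proof. by rewrite cc' => -[v _ <-]; exists v. Qed.

Lemma polar_form_sesquilinear : sesquilinear_on (range c) polar_form.
Proof.
split=> a _ y z [x _ <-].
  move=> [{}y _ <-] /range_c'[{}z ->].
  rewrite -(adjZ _ _ cs) -(adjD _ _ cs) !polar_formE.
  by rewrite (adjD _ _ ss) (adjZ _ _ ss) (adjD _ _ UV) (adjZ _ _ UV) ipDl ipZl.
move=> /range_c'[{}y ->] /range_c'[{}z ->].
rewrite -(adjZ _ _ cs') -(adjD _ _ cs') !polar_formE.
by rewrite (adjD _ _ ss') (adjZ _ _ ss') ipDr ipZr.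
Qed.

(** With F, F' the roots of |T|, |T*|: the relation <U F x, F' y> = <z, y> for all y says F' U F x =
    z, as F' is self-adjoint. Since F' = U F V and V U fixes the range of F, this is z = U F F x = T
    x. *)
Lemma polar_form_assoc : associated_op polar_form = T.
Proof.
apply/seteqP; split=> -[x y].
  move=> [/= [u _ <-] hu].
  have : cs_graph c' s' (U (s u), y).
    have [_ _ <-] := cs_selfadjoint csp'; move=> _ _ [v /= -> ->].
    have Dv : range c (c' v) by rewrite cc'; exists v.
    by rewrite ipC -polar_formE /= (hu _ Dv) -ipC.
  rewrite FE' => -[w /= ]; rewrite VUs => Fw ->.
  by apply/TE; exists w => //; exists (s u); split=> //; exists u.
move=> /TE[w [m [[u /= -> ->] Fw]] ->]; split; first by exists u.
move=> _ /range_c'[v ->]; rewrite polar_formE.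
have G1 : cs_graph c' s' (U (s u), U w) by rewrite FE'; exists w => //=; rewrite VUs.
have G2 : cs_graph c' s' (c' v, s' v) by exists v.
by rewrite (selfadjointE (cs_selfadjoint csp') G1 G2).
Qed.

Lemma cs_norm_le_dual : exists2 C : R, 0 <= C &
  forall x, cs_norm c' (c x) <= (C * nm x)%:C.
Proof.
apply: (complete_norm_le csp (alpha := 1)) => //.
- by rewrite cc'; exact: cs_norm_is_norm csp'.
- by rewrite cc'; exact: cs_norm_complete csp'.
- move=> _ /range_c'[v ->]; rewrite mul1r /cs_norm (cinvK _ csp') !nmE lecR.
  exact: cs_c_le csp'.
Qed.

Lemma cs_dual_norm_le : exists2 C : R, 0 <= C &
  forall x, cs_norm c (c' x) <= (C * nm x)%:C.
Proof.
apply: (complete_norm_le csp' (alpha := 1)) => //.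
- by rewrite -cc'; exact: cs_norm_is_norm csp.
- by rewrite -cc'; exact: cs_norm_complete csp.
- move=> y; rewrite -cc' => -[v _ <-]; rewrite mul1r /cs_norm (cinvK _ csp) !nmE lecR.
  exact: cs_c_le csp.
Qed.

Lemma polar_form_bound u v : cn (polar_form (c u) (c' v)) <= nm u * nm v.
Proof.
rewrite polar_formE; apply: le_trans (cauchy_schwarz _ _) _.
apply: ler_pM; rewrite ?nm_ge0//; last exact: cs_s_le csp'.
exact: le_trans (Uc _) (cs_s_le _ csp).
Qed.

Lemma polar_form_q_closed : q_closed polar_form (cs_norm c).
Proof.
split.
- exact: cs_norm_is_norm csp.
- exists 1 => // _ [u _ <-]; rewrite mul1r /cs_norm (cinvK _ csp) !nmE lecR.
  exact: cs_c_le csp.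
- split; [exact: cs_norm_complete csp|exact: cs_norm_reflexive csp].
have [C C0 CP] := cs_norm_le_dual.
exists (C + 1)%:C; first by rewrite ltcR; lra.
move=> _ _ [u _ <-] [v _ <-].
have [v' vE] : exists v', c v = c' v' by apply: range_c'; exists v.
have := CP v; rewrite vE /cs_norm (cinvK _ csp') -vE !(cinvK _ csp) vE !nmE lecR => h.
rewrite cnE -!rmorphM lecR; apply: le_trans (polar_form_bound _ _) _.
rewrite mulrAC mulrC ler_wpM2r ?nm_ge0//.
by have := nm_ge0 v; lra.
Qed.

Lemma polar_form_solvable (B : {linear H -> H}) : bounded_op B ->
  resolvent_set (op_add T (graph_of B)) 0 -> solvable polar_form.
Proof.
move=> [k kB] [S0 _ SE].
have onto h : exists u z, T (u, z) /\ h = z + B u.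
  have : graph_of S0 (h, S0 h) := erefl.
  rewrite -SE => -[y [z [[a [b [/= Ta bE ->]] zE hE]]]].
  exists (S0 h), a; split=> //; rewrite /graph_of /= in zE bE hE.
  by rewrite [LHS]hE zE bE scale0r oppr0 addr0.
have inj x z : T (x, z) -> z + B x = 0 -> x = 0.
  move=> Txz e; have : graph_of S0 (0, x).
    rewrite -SE; exists 0, 0; split; rewrite /graph_of /= ?scale0r ?oppr0 ?addr0//.
    by exists z, (B x).
  by rewrite /graph_of /= linear0.
have [cso csd _] := cs_selfadjoint csp.
split.
- apply/subspaceP; split; first by exists 0 => //; exact: adj0 cs.
  move=> a _ _ [x _ <-] [y _ <-]; exists (a *: x + y) => //.
  by rewrite (adjD _ _ cs) (adjZ _ _ cs).
- by rewrite /= -(dom_cs_graph c s).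
- exact: polar_form_sesquilinear.
exists (cs_norm c); first exact: polar_form_q_closed.
exists (fun x y => <|B x, y|>); split.
- split; first split.
  + by move=> a x y z _ _ _; rewrite linearP ipDl ipZl.
  + by move=> a x y z _ _ _; rewrite ipDr ipZr.
  exists k => x y; apply: (@le_trans _ _ (`|B x| * `|y|)).
    by rewrite cnE !nmE -rmorphM lecR; exact: cauchy_schwarz.
  by rewrite ler_wpM2r.
- move=> x Dx hx; apply: (inj x (- B x)); last by rewrite addNr.
  rewrite -polar_form_assoc; split=> // y Dy /=; rewrite ipNl.
  by apply/eqP; rewrite -addr_eq0 hx.
move=> L [Ll [kL [kL0 LB]]].
have [C C0 CP] := cs_dual_norm_le.
(* L (c' v) = <g, v> = <c' g, c' v> + <s' g, s' v>. *)
have [|g gP] := @cs_antidual _ _ c' s' L csp'.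
  rewrite -cc'; split=> //; exists (kL * C%:C).
  split; first by rewrite mulr_ge0// lecR.
  move=> y Dy; apply: le_trans (LB y Dy) _.
  have [v ->] := range_c' Dy.
  rewrite -mulrA ler_wpM2l//; apply: le_trans (CP v) _.
  by rewrite /cs_norm (cinvK _ csp') nmE -rmorphM.
have : cs_graph c' s' (c' g, s' g) by exists g.
(* Here V (c' g) = c u and s' g = U (s u), so the second term is the form at (c u, c' v). *)
rewrite FE' => -[w [u /= Vu ->] sU].
(* The correction a absorbs the first term together with the unwanted <B (c u), y>. *)
have [a [z [Ta hE]]] := onto (c' g - B (c u)).
have [[b _ bE] hb] : associated_op polar_form (a, z) by rewrite polar_form_assoc.
rewrite /= in bE hb.
exists (c u + a); first by exists (u + b) => //; rewrite (adjD _ _ cs) bE.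
move=> y Dy.
have add : polar_form (c u + a) y = polar_form (c u) y + <|z, y|>.
  have := proj1 polar_form_sesquilinear 1 (c u) a y.
  rewrite scale1r mul1r => ->//; last by exists b.
  by congr (_ + _); exact: hb.
rewrite -[X in _ = X + _]/(polar_form (c u + a) y) add.
rewrite linearD ipDl.
have [v yE] := range_c' Dy; rewrite yE polar_formE -sU gP.
have [_ _ E' _ _] := csp'.
rewrite -{1}(E' g) ipDl cs' ss'.
have -> : <|c' g, c' v|> = <|B (c u), c' v|> + <|z, c' v|> + <|B a, c' v|>.
  by rewrite -!ipDl -addrA -hE addrC subrK.
by ring.
Qed.

Lemma polar_form_unique O' : solvable O' -> fdom O' = range c ->
  associated_op O' = T -> form_eq O' polar_form.
Proof.
move=> [_ _ [Ol _] [N [N1 [al al0 Nal] [N2 _] [be be0 Nbe]] _]] DE OT.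
rewrite DE in Ol N1 Nal N2 Nbe *.
split=> // x y; rewrite DE => -[u _ <-] Dy.
have [C C0 CP] := complete_norm_le csp N1 N2 al0 Nal.
have [v vE] := range_c' Dy.
have [Ny0 _ _ _] := N1.
have [NyE Ny] := pos_ReE (Ny0 _ Dy).
have NcE w : N (c w) = (complex.Re (N (c w)))%:C.
  by have [] := pos_ReE (Ny0 (c w) (ex_intro2 _ _ w I erefl)).
apply/eqP; rewrite -subr_eq0; apply/eqP.
apply: (@cn_eps _ _ (cn be * C * complex.Re (N y) + nm v)) => e e0.
(* D(T) is the range of c^2, and c is isometric for the graph norm; so c (c h) in D(T) is as close
   to c u in that norm as c h is to u in H. *)
have [h hu] := cs_range_dense csp u e0.
pose d := u - c h.
have du : nm d <= e by rewrite /d nmC ltW.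
have Th : T (c (c h), U (s (s h))).
  apply/TE; exists (s (s h)) => //; exists (s (c h)); split; first by exists (c h).
  by exists (s h) => //=; case: csp => _ ->.
have uE : c u = 1 *: c d + c (c h).
  by rewrite scale1r -(adjD _ _ cs) /d subrK.
have e1 : O' (c u) y = O' (c d) y + <|U (s (s h)), y|>.
  rewrite uE Ol//.
  have [_ /= ->//] : associated_op O' (c (c h), U (s (s h))) by rewrite OT.
    by rewrite mul1r.
  by rewrite DE.
have e2 : polar_form (c u) y = polar_form (c d) y + <|U (s (s h)), y|>.
  rewrite uE (proj1 polar_form_sesquilinear)//.
  have [_ /= ->//] : associated_op polar_form (c (c h), U (s (s h))).
    by rewrite polar_form_assoc.
  by rewrite mul1r.
rewrite e1 e2 opprD addrACA subrr addr0.
apply: le_trans (cnD _ _) _; rewrite cnN mulrDr; apply: lerD.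
  have := Nbe (c d) y (ex_intro2 _ _ d I erefl) Dy.
  rewrite cnE NyE => /(lec_real Ny) /le_trans; apply.
  rewrite mulrA; apply: ler_wpM2r => //; rewrite cnM mulrA [e * _]mulrC -mulrA.
  apply: ler_wpM2l; first exact: cn_ge0.
  have := CP d; rewrite NcE lecR cn_real => Nd.
  rewrite ger0_norm; last by have [] := pos_ReE (Ny0 (c d) (ex_intro2 _ _ d I erefl)).
  by apply: le_trans Nd _; rewrite mulrC; apply: ler_wpM2r.
rewrite vE; apply: le_trans (polar_form_bound _ _) _.
by apply: ler_wpM2r => //; exact: nm_ge0.
Qed.

End HyperSolvable.

Unset Implicit Arguments.

Theorem theorem5p1 (R : realType) (H : hilbert R) (T : graph H)
  (T_operator : is_operator T)
  (T_dense : dense (dom T))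
  (T_closed : closed_op T)
  (T_dom : dom (op_sqrt (op_abs T)) = dom (op_sqrt (op_abs (adjoint T))))
  (T_resolvent : exists2 B : {linear H -> H}, bounded_op B &
     resolvent_set (op_add T (graph_of B)) 0) :
  exists O : sform H,
    [/\ hyper_solvable O, associated_op O = T &
        forall O' : sform H, hyper_solvable O' -> associated_op O' = T ->
          form_eq O' O].
Proof.
have [c [s [c' [s' [U [V [[csp FE] [csp' GE] [UV Uc VUs] FG TE]]]]]]] :=
  op_abs_dual_sqrt T_operator T_closed T_dense.
rewrite FE GE !dom_cs_graph in T_dom.
have [B Bb Br] := T_resolvent.
have assoc := polar_form_assoc csp csp' VUs FG TE T_dom.
exists (polar_form c s c' s' U); split=> //.
  split; first exact: (polar_form_solvable csp csp' UV Uc VUs FG TE T_dom Bb Br).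
  by rewrite assoc FE dom_cs_graph.
move=> O' [sol dE] OT; rewrite OT FE dom_cs_graph in dE.
exact: (polar_form_unique csp csp' UV Uc VUs FG TE T_dom sol dE OT).
Qed.
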